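(* Let $\eta=\sum_{\lambda\in\Lambda}\delta_{(z_\lambda,v_\lambda)}$ be, under $\mathbb{Q}$, a Poisson point process on $\Sigma\times\mathbb{R}_+$ with intensity $\mu\otimes dv$, and let $(Z_k)_{k\ge1}$ be a Markov chain on $\Sigma$ with transition densities $g(\cdot,\cdot)$ with respect to $\mu$ and $Z_1$ distributed as $g(Z_0,z)\mu(dz)$. Set $G_0\equiv0$ and $z_0=Z_0$. Then one can proceed iteratively, for all $n\ge1$, to define ($\mathbb{Q}$-almost surely) $\xi_n$, $G_n$ and $(z_n,v_n)$ by $$\xi_n=\inf\big\{t\ge0:\ \exists\,(z_\lambda,v_\lambda)\notin\{(z_k,v_k)\}_{k=1}^{n-1}\text{ with }G_{n-1}(z_\lambda)+t\,g(z_{n-1},z_\lambda)\ge v_\lambda\big\},$$ $$G_n(z)=G_{n-1}(z)+\xi_n\,g(z_{n-1},z),\quad z\in\Sigma,$$ $$(z_n,v_n)\ \text{the unique pair }(z_\lambda,v_\lambda)\notin\{(z_k,v_k)\}_{k=1}^{n-1}\text{ with }G_n(z_\lambda)=v_\lambda,$$ and for all $n\ge1$: $(z_1,\dots,z_n)$ has the same law as $(Z_1,\dots,Z_n)$ and is independent of $(\xi_1,\dots,\xi_n)$; and the point process $$\sum_{(z_\lambda,v_\lambda)\notin\{(z_k,v_k)\}_{k=1}^n}\delta_{(z_\lambda,\,v_\lambda-G_n(z_\lambda))}$$ is distributed as $\eta$ and independent of $(z_1,\dots,z_n,\xi_1,\dots,\xi_n)$.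
   Context: $\Sigma$ is a locally compact Polish metric space with Borel $\sigma$-algebra $\mathcal{B}$, and $\mu$ is a Radon measure on it (finite on compacts). Point measures $\eta=\sum_{\lambda\in\Lambda}\delta_{(z_\lambda,v_\lambda)}$ on $\Sigma\times\mathbb{R}_+$ have countable index set $\Lambda$ and are finite on compact sets; $dv$ is Lebesgue measure on $\mathbb{R}_+$. The Markov chain satisfies $\mathcal{P}[Z_{k+1}\in dz\mid Z_k]=g(Z_k,z)\mu(dz)$ for $k\ge1$, where $g:\Sigma\times\Sigma\to\mathbb{R}_+$ is $\mathcal{B}$-measurable in each coordinate and integrates to one with respect to $\mu$ in the second coordinate. The chain starts at time one; $Z_0$ is only a notation: $g(Z_0,\cdot)$ denotes the $\mu$-density of the law of $Z_1$.
   Formalization: The transition density g is assumed jointly measurable on Σ×Σ rather than only measurable in each coordinate; with separate measurability alone, ξ_2 need not be a random variable (e.g. g = 1 + 1_E with E a Sierpiński non-measurable set with finite sections). *)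

(* Defs.v *)
From HB Require Import structures.
From mathcomp Require Import all_boot all_order all_algebra.
From mathcomp Require Import all_classical all_reals all_analysis.
From mathcomp Require Import measurable_realfun.

Set Implicit Arguments.
Unset Strict Implicit.
Unset Printing Implicit Defensive.

Import Order.TTheory GRing.Theory Num.Theory.
Import numFieldNormedType.Exports.

Local Open Scope classical_set_scope.
Local Open Scope ring_scope.

#[short(type="completePMetricType")]
HB.structure Definition CompletePointedMetric (R : numDomainType) :=
  {T of Metric R T & Complete T & Pointed T}.

Definition separable (T : topologicalType) :=
  exists2 D : set T, countable D & dense D.

Definition borel (T : ptopologicalType) : measurableType _ :=
  g_sigma_algebraType (@open T).

Definition finite_on_compacts (R : realType) (T : topologicalType)
    (m : set T -> \bar R) :=
  forall K : set T, compact K -> (m K < +oo)%E.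

Section laws.
Context (R : realType) (d d' e e' : measure_display).
Context (T : measurableType d) (T' : measurableType d').
Context (E : measurableType e) (E' : measurableType e').

Definition equal_in_law (P : probability T R) (X : T -> E)
    (P' : probability T' R) (X' : T' -> E) :=
  forall A, measurable A -> pushforward P X A = pushforward P' X' A.

Definition independent (P : probability T R) (X : T -> E) (Y : T -> E') :=
  forall A B, measurable A -> measurable B ->
    P (X @^-1` A `&` Y @^-1` B) = (P (X @^-1` A) * P (Y @^-1` B))%E.

End laws.

(* (X_1, ..., X_n), for a sequence whose entries of interest start at 1 *)
Definition initial_segment (T E : Type) (X : nat -> T -> E) (n : nat) (w : T) :
  n.-tuple E := [tuple X i.+1 w | i < n].

Section markov_chain.
Context (R : realType) (d e : measure_display).
Context (T : measurableType d) (E : measurableType e).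

(* The chain starts at time 1 and Z 0 is irrelevant; g0 is the density of the
   law of Z 1.  The last clause is the defining property of the conditional
   probability
     P[Z_{k+1} \in A | Z_1, ..., Z_k] = \int_A g(Z_k, x) mu(dx). *)
Definition markov_chain (P : probability T R) (mu : set E -> \bar R)
    (g0 : E -> R) (g : E -> E -> R) (Z : nat -> T -> E) :=
  [/\ forall k, (0 < k)%N -> measurable_fun setT (Z k),
      forall A, measurable A ->
        P (Z 1%N @^-1` A) = (\int[mu]_(x in A) (g0 x)%:E)%E
    & forall k (C : set (k.-tuple E)) (A : set E), (0 < k)%N ->
        measurable C -> measurable A ->
        P (initial_segment Z k @^-1` C `&` Z k.+1 @^-1` A) =
        (\int[P]_(w in initial_segment Z k @^-1` C)
           \int[mu]_(x in A) (g (Z k w) x)%:E)%E].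

End markov_chain.

Section point_measures.
Context (R : realType) (S : ptopologicalType).

(* Points of S x R_+ are taken in S x R; the constraint 0 <= v is imposed on
   the point process and on its intensity measure. *)
Definition point_space := (borel S * measurableTypeR R)%type.

(* A countable family of points (with possible repetitions), standing for the
   point measure which is the sum of their Dirac masses.  How the points are
   indexed is irrelevant: the sigma-algebra on families, generated by the
   evaluations c |-> mass c A, only sees the point measures. *)
Record point_family := PointFamily {
  pindex : set nat ;
  patom : nat -> S * R }.

HB.instance Definition _ := gen_eqMixin point_family.
HB.instance Definition _ := gen_choiceMixin point_family.
HB.instance Definition _ :=
  isPointed.Build point_family (PointFamily set0 (fun=> (point, 0))).

Definition mass (c : point_family) (A : set (S * R)) : \bar R :=
  \esum_(i in pindex c) (\1_A (patom c i))%:E.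

Definition atoms (c : point_family) : set (S * R) := patom c @` pindex c.

Definition evaluation_sets : set (set point_family) :=
  [set B | exists (A : set point_space) (C : set \bar R),
     [/\ measurable A, measurable C & B = mass^~ A @^-1` C]].

Definition point_measures : measurableType _ :=
  g_sigma_algebraType evaluation_sets.

(* The library's poisson_prob r k is the Poisson law of parameter r; its
   argument k is a dummy. *)
Definition poisson_point_process (d : measure_display) (T : measurableType d)
    (P : probability T R) (nu : set point_space -> \bar R)
    (eta : T -> point_measures) :=
  [/\ measurable_fun setT eta,
      forall A, measurable A -> (nu A < +oo)%E -> forall k : nat,
        P [set w | mass (eta w) A = k%:R%:E] =
        poisson_prob (fine (nu A)) 0%N [set k],
      forall A, measurable A -> nu A = +oo%E ->
        P [set w | mass (eta w) A = +oo%E] = 1%E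
    & forall n (A : 'I_n -> set point_space) (C : 'I_n -> set \bar R),
        (forall i, measurable (A i)) -> (forall i, measurable (C i)) ->
        trivIset setT A ->
        P (\bigcap_i [set w | C i (mass (eta w) (A i))]) =
        (\prod_(i < n) P [set w | C i (mass (eta w) (A i))])%E].

(* mu (x) dv, with dv the Lebesgue measure on R_+ *)
Definition intensity (mu : {measure set borel S -> \bar R})
    (A : set point_space) : \bar R :=
  (mu \x lebesgue_measure)%E (A `&` [set p | 0 <= (p.2 : R)]).

End point_measures.

Section soft_local_times.
Context (R : realType) (S : ptopologicalType).
Implicit Types (g : S -> S -> R) (c : point_family R S).
Implicit Types (xi v : nat -> R) (z : nat -> S) (n : nat).

(* g(z_n, .), with g(z_0, .) := g0; the value z 0 is irrelevant *)
Definition step_density (g0 : S -> R) g z n : S -> R := if n is 0 then g0 else g (z n).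

Fixpoint soft_local_time (g0 : S -> R) g xi z n (x : S) : R :=
  if n is m.+1 then
    soft_local_time g0 g xi z m x + xi m.+1 * step_density g0 g z m x
  else 0.

Definition explored z v n : set (S * R) :=
  [set (z k, v k) | k in [set k | (1 <= k <= n)%N]].

(* Construction of xi_{n+1} and (z_{n+1}, v_{n+1}).  The infimum is taken in
   the extended reals, so that the first equation entails that the set on its
   right-hand side is nonempty. *)
Definition soft_local_time_step (g0 : S -> R) g c xi z v n : Prop :=
  let G := soft_local_time g0 g xi z in
  let remaining := atoms c `\` explored z v n in
  (xi n.+1)%:E = ereal_inf [set t%:E | t in [set t : R | 0 <= t /\
     exists2 p, remaining p & p.2 <= G n p.1 + t * step_density g0 g z n p.1]]
  /\ [set p | remaining p /\ G n.+1 p.1 = p.2] = [set (z n.+1, v n.+1)].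

(* the point measure with points (z_i, v_i - G_n(z_i)), where (z_i, v_i) ranges
   over the points of c other than (z_1, v_1), ..., (z_n, v_n) *)
Definition residual (g0 : S -> R) g c xi z v n : point_family R S :=
  PointFamily (pindex c `\` [set i | explored z v n (patom c i)])
    (fun i => let p := patom c i in
              (p.1, p.2 - soft_local_time g0 g xi z n p.1)).

Definition soft_local_time_construction (d : measure_display)
    (T : measurableType d) (Q : probability T R) (g0 : S -> R) g
    (eta : T -> point_measures R S)
    (xi : nat -> T -> R) (z : nat -> T -> borel S) (v : nat -> T -> R) :=
  (forall n, (0 < n)%N -> [/\ measurable_fun setT (xi n),
     measurable_fun setT (z n) & measurable_fun setT (v n)]) /\
  {ae Q, forall w, forall n,
     soft_local_time_step g0 g (eta w) (xi^~ w) (z^~ w) (v^~ w) n}.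

End soft_local_times.

(* Main.v *)
Require Import Defs.
From HB Require Import structures.
From mathcomp Require Import all_boot all_order all_algebra.
From mathcomp Require Import all_classical all_reals all_analysis.
From mathcomp Require Import finmap measurable_realfun ring.

(** Everything rests on Mecke's formula ([mecke_formula]): the expected sum of
    [F(p, eta)] over the points [p] of a Poisson process [eta] of intensity [nu]
    is the integral against [nu(dp)] of the expectation of [F(p, eta + delta_p)].

    Fix a probability density [f] with respect to [mu] and let the graph of
    [t f] grow with [t].  Say that [p = (x, v)], which the graph reaches at
    [t = v / f(x)], is the first point of [eta] when it is the only one below the
    graph of [t f].  Apply Mecke's formula to the event that [p] is the first
    point of [eta], that [x] is in [A], that [t] is in [T], and that the points
    above the graph, once lowered by [t f], form a configuration in [B].  After
    the addition of [p] to [eta], this event says that [eta] has no point below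
    the graph of [t f], which has probability [exp(-t)] since the region below
    the graph has mass [t], and that what lies above is in [B]; the latter is
    independent of the former and has probability [P(eta in B)], because [nu] is
    invariant under vertical translations ([void_strip_law]).  Integrating over
    [v], the first point has its position in [A], its time in [T] and its residue
    in [B] with probability
      [(integral of f over A) * Exp(1)(T) * P(eta in B)]    ([hits_law]).
    A configuration has at most one first point ([is_first_uniq]), and the total
    mass in this formula is one: so a first point exists almost surely, which
    means that the infimum defining [xi_n] is attained, and at a single point.

    The [n]-th step of the construction explores in this way the residual process
    of the first [n - 1] steps, with a density [g(z_{n-1}, .)] which is random but
    depends on [z_1, ..., z_{n-1}] only.  By induction, the residual process is
    independent of [(z_1, ..., z_{n-1})], which has the law of the chain, of
    [(xi_1, ..., xi_{n-1})] and has the law of [eta]; hence [hits_law] can be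
    integrated against the law of [(z_1, ..., z_{n-1})], and the Markov property
    of [Z] identifies the result ([exploration_law_next]).  This also shows that
    the next step is possible almost surely ([explorable_ae]), which gives the
    existence of the construction.

    Identities between laws of point processes are checked on the events that
    prescribe the numbers of points in the cells of a finite partition
    ([point_measures_unique]). *)

Set Implicit Arguments.
Unset Strict Implicit.
Unset Printing Implicit Defensive.

Import Order.TTheory GRing.Theory Num.Theory.
Import numFieldNormedType.Exports.

Local Open Scope classical_set_scope.
Local Open Scope ring_scope.

(** * The mass of a point family, as a measure *)

Section mass.
Context (R : realType) (S : ptopologicalType).
Implicit Types (c : point_family R S) (A B : set (S * R)).
Local Open Scope ereal_scope.

(** Counting the indices, rather than the points, takes multiplicities into
    account. *)
Lemma mass_counting c A :
  mass c A = counting (pindex c `&` patom c @^-1` A).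
Proof.
rewrite counting_dirac nneseries_esumT//.
rewrite /mass esum_mkcond; apply: eq_esum => i _.
rewrite diracE indicE in_setI; case: (i \in pindex c) => //=.
Qed.

Definition mass_measure c : set (point_space R S) -> \bar R := mass c.

Let mass0 c : mass_measure c set0 = 0.
Proof. by rewrite /mass_measure mass_counting preimage_set0 setI0 measure0. Qed.

Let mass_ge0 c A : 0 <= mass_measure c A.
Proof. by rewrite /mass_measure mass_counting measure_ge0. Qed.

Let mass_sigma_additive c : semi_sigma_additive (mass_measure c).
Proof.
move=> F mF tF mUF; rewrite /mass_measure mass_counting preimage_bigcup.
rewrite setI_bigcupr.
under eq_fun do under eq_bigr do rewrite mass_counting.
apply: (@measure_semi_sigma_additive _ nat R counting) => //.
apply/trivIsetP => i j _ _ ij; apply/seteqP; split => // k [[_ Fi] [_ Fj]].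
move/trivIsetP : tF => /(_ i j Logic.I Logic.I ij) /seteqP[/(_ (patom c k)) + _].
by apply; split; [exact: Fi|exact: Fj].
Qed.

HB.instance Definition _ c := isMeasure.Build _ _ _ (mass_measure c)
  (mass0 c) (mass_ge0 c) (@mass_sigma_additive c).

Lemma massE c : mass c = mass_measure c. Proof. by []. Qed.

Lemma mass_values c A : mass c A = +oo \/ exists n : nat, mass c A = n%:R%:E.
Proof.
by rewrite mass_counting /counting; case: ifPn => _; [right; eexists|left].
Qed.

Lemma mass_eq0 c A :
  mass c A = 0 <-> forall i, pindex c i -> ~ A (patom c i).
Proof.
rewrite mass_counting /counting; split.
  case: ifPn => // /asboolP fin [] /eqP.
  rewrite pnatr_eq0 cardfs_eq0 => /eqP/(congr1 (fun X => [set` X])).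
  rewrite fset_setK// => e0 i ci Ai.
  by have : [set` (fset0 : {fset nat})] i by rewrite -e0; split.
move=> h; rewrite (_ : _ `&` _ = set0) ?asboolT ?fset_set0//.
by apply/seteqP; split => // i [/= /h].
Qed.

Lemma mass_eq1 c A : mass c A = 1 <->
  exists i, pindex c `&` patom c @^-1` A = [set i].
Proof.
rewrite mass_counting /counting; split.
  case: ifPn => // /asboolP fin [] /eqP.
  rewrite pnatr_eq1 => /cardfs1P[i] /(congr1 (fun X => [set` X])).
  rewrite fset_setK// => e; exists i; rewrite e; apply/seteqP; split => j /=;
    by rewrite inE => /eqP.
by move=> [i ->]; rewrite asboolT// fset_set1 cardfs1.
Qed.

Lemma mass_eq01 c A :
  (forall i j, pindex c i -> pindex c j -> A (patom c i) -> A (patom c j) ->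
    i = j) -> mass c A = 0 \/ mass c A = 1.
Proof.
move=> inj; have [[i [ci Ai]]|no] := pselect (exists i, pindex c i /\ A (patom c i)).
  right; apply/mass_eq1; exists i; apply/seteqP; split => [j [cj Aj]|_ ->].
    exact: inj.
  by split.
by left; apply/mass_eq0 => i ci Ai; apply: no; exists i.
Qed.

Lemma measurable_mass (A : set (point_space R S)) : measurable A ->
  measurable_fun setT (fun c : point_measures R S => mass c A).
Proof.
move=> mA _ C mC; rewrite setTI; apply: sub_sigma_algebra.
by exists A, C.
Qed.

Lemma measurable_to_point_measures d (T : measurableType d)
    (c : T -> point_measures R S) :
  (forall A : set (point_space R S), measurable A ->
     measurable_fun setT (fun x => mass (c x) A)) ->
  measurable_fun setT c.
Proof.
move=> mc; apply: (@measurability _ _ _ _ _ c (@evaluation_sets R S)) => //.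
move=> _ [_ [A [C [mA mC ->]]] <-]; rewrite setTI.
by rewrite -[X in measurable X]setTI; exact: mc.
Qed.

Lemma measurable_mass_comp d (T : measurableType d)
    (c : T -> point_measures R S) (A : set (point_space R S)) :
  measurable_fun setT c -> measurable A ->
  measurable_fun setT (fun x => mass (c x) A).
Proof.
by move=> mc mA; apply: (measurableT_comp (measurable_mass mA)).
Qed.

End mass.

(** * Measurable dependence of the mass of a section *)

Section mass_kernel.
Context (R : realType) (S : ptopologicalType) d (T : measurableType d).
Variables (c : T -> point_measures R S) (mc : measurable_fun setT c).
Variable K : nat -> set (point_space R S).
Hypothesis mK : forall n, measurable (K n).
Hypothesis ndK : nondecreasing_seq K.
Hypothesis UK : \bigcup_n K n = setT.
Hypothesis finK : forall x n, (mass (c x) (K n) < +oo)%E.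

Let kmass (mc' : measurable_fun setT c) (x : T) :
  {measure set (point_space R S) -> \bar R} := mass_measure (c x).

Let measurable_kmass U : measurable U -> measurable_fun setT (kmass mc ^~ U).
Proof. exact: measurable_mass_comp. Qed.

HB.instance Definition _ := isKernel.Build _ _ _ _ _ (kmass mc)
  measurable_kmass.

(** Local finiteness is what makes the mass a kernel: on each [K n] the masses
    are finite, so that the class of good sets is closed under differences. *)
Lemma measurable_mass_xsection (W : set (T * point_space R S)) :
  measurable W -> measurable_fun setT (fun x => mass (c x) (xsection W x)).
Proof.
move=> mW.
have mWn n : measurable_fun setT
    (fun x => mass_measure (c x) (xsection W x `&` K n)).
  have := @measurable_prod_subset_xsection_kernel _ _ _ _ R (kmass mc) (K n)
    (mK n).
  move=> /(_ _ W mW)[]//.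
  move=> x; have fKn : mass (c x) (K n) \is a fin_num.
    by rewrite ge0_fin_numE// massE measure_ge0.
  exists (fine (mass (c x) (K n)) + 1)%R => X mX.
  have h : (mass_measure (c x) (X `&` K n) <= mass_measure (c x) (K n))%E.
    by apply: le_measure; [exact/mem_set/measurableI|exact/mem_set|].
  rewrite /mrestr /=; apply: (le_lt_trans h).
  by rewrite -massE -[X in (X < _)%E](fineK fKn) lte_fin ltrDl.
apply: (emeasurable_fun_cvg (fun n x =>
  mass_measure (c x) (xsection W x `&` K n))) => //.
move=> x _; rewrite [X in _ --> X](_ : _ =
    mass_measure (c x) (\bigcup_n (xsection W x `&` K n))); last first.
  by rewrite -setI_bigcupr UK setIT.
apply: nondecreasing_cvg_mu.
- by move=> n; apply: measurableI => //; exact: measurable_xsection.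
- apply: bigcup_measurable => n _.
  by apply: measurableI => //; exact: measurable_xsection.
- move=> m n mn; apply/subsetPset; apply: setIS; apply/subsetPset; exact: ndK.
Qed.

End mass_kernel.

(** * Uniqueness of finite measures *)

Section finite_measures.
Context (R : realType).
Local Open Scope ereal_scope.

Lemma finite_measure_unique d (T : measurableType d) (G : set (set T))
    (m1 m2 : {measure set T -> \bar R}) :
  measurable = <<s G >> -> setI_closed G -> G setT -> m1 setT < +oo ->
  (forall A, G A -> m1 A = m2 A) -> forall A, measurable A -> m1 A = m2 A.
Proof.
move=> mG GI GT m1T m12 A mA; apply: (measure_unique G (fun=> setT)) => //.
by apply/seteqP; split => // x _; exists 0%N.
Qed.

Lemma finite_measure_unique_rectangles d1 d2 (T1 : measurableType d1)
    (T2 : measurableType d2) (m1 m2 : {measure set (T1 * T2) -> \bar R}) :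
  m1 setT < +oo ->
  (forall A B, measurable A -> measurable B -> m1 (A `*` B) = m2 (A `*` B)) ->
  forall X, measurable X -> m1 X = m2 X.
Proof.
move=> m1T m12; apply: (finite_measure_unique
  (G := [set A `*` B | A in measurable & B in measurable])) => //.
- exact: measurable_prod_measurableType.
- move=> _ _ [X1 mX1 [X2 mX2 <-]] [Y1 mY1 [Y2 mY2 <-]].
  exists (X1 `&` Y1); first exact: measurableI.
  by exists (X2 `&` Y2); [exact: measurableI|rewrite setXI].
- by exists setT => //; exists setT => //; rewrite setXTT.
- by move=> _ [A mA [B mB <-]]; exact: m12.
Qed.

Lemma measure_finite_partition d (T : measurableType d) (I : finType)
    (m : {measure set T -> \bar R}) (A : set T) (B : I -> set T) :
  measurable A -> (forall i, measurable (B i)) -> trivIset setT B ->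
  \bigcup_i B i = setT -> m A = \sum_(i : I) m (A `&` B i).
Proof.
move=> mA mB tB UB; rewrite -{1}(setIT A) -UB setI_bigcupr measure_fin_bigcup//.
- rewrite (_ : setT = [set` index_enum I]); last first.
    by apply/seteqP; split => // i _ /=; rewrite mem_index_enum.
  by rewrite -fsbig_seq// index_enum_uniq.
- exact: finite_finset.
- by apply: trivIset_setIl.
- by move=> i _; exact: measurableI.
Qed.

Lemma measure_eq_exhaustion d (T : measurableType d)
    (m1 m2 : {measure set T -> \bar R}) (F : nat -> set T) W :
  (forall n, measurable (F n)) -> nondecreasing_seq F ->
  \bigcup_n F n = setT -> measurable W ->
  (forall n, m1 (W `&` F n) = m2 (W `&` F n)) -> m1 W = m2 W.
Proof.
move=> mF ndF UF mW m12.
have cvgW (m : {measure set T -> \bar R}) : m (W `&` F n) @[n --> \oo] --> m W.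
  rewrite -[X in _ --> m X]setIT -UF setI_bigcupr.
  apply: nondecreasing_cvg_mu.
  - by move=> n; exact: measurableI.
  - by apply: bigcup_measurable => n _; exact: measurableI.
  - by move=> n k nk; apply/subsetPset; apply: setIS; apply/subsetPset; exact: ndF.
apply: (cvg_unique _ (cvgW m1)) => //.
have /= := cvgW m2; rewrite (_ : (fun n => m2 _) = (fun n => m1 (W `&` F n)))//.
by apply/funext => n; rewrite m12.
Qed.

End finite_measures.

Section as_sigma_finite.
Context d (T : measurableType d) (R : realType).
Variables (m : {measure set T -> \bar R}) (m_sigma_finite : sigma_finite setT m).

(** The proof is an argument so that the structure of sigma-finite measure can
    be inferred. *)
Definition as_sigma_finite & sigma_finite setT m : set T -> \bar R := m.

HB.instance Definition _ := Measure.on (as_sigma_finite m_sigma_finite).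
HB.instance Definition _ := Measure_isSigmaFinite.Build _ _ _
  (as_sigma_finite m_sigma_finite) m_sigma_finite.

End as_sigma_finite.

(** * The cylinders of finite partitions generate the point measures *)

Section cylinders.
Context (R : realType) (S : ptopologicalType).
Local Notation X := (point_space R S).
Local Notation N := (point_measures R S).
Local Open Scope ereal_scope.

Definition finite_partition (I : finType) (A : I -> set X) :=
  [/\ forall i, measurable (A i), trivIset setT A & \bigcup_i A i = setT].

Definition counts_are (I : Type) (A : I -> set X) (k : I -> \bar R) : set N :=
  [set c | forall i, mass c (A i) = k i].

Lemma measurable_counts_are (I : finType) (A : I -> set X) k :
  (forall i, measurable (A i)) -> measurable (counts_are A k).
Proof.
move=> mA; rewrite (_ : counts_are A k =
    \bigcap_(i in [set: I]) ((fun c => mass c (A i)) @^-1` [set k i])); last first.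
  by apply/seteqP; split => [c ck i _|c ck i]; [exact: ck|exact: (ck i Logic.I)].
apply: fin_bigcap_measurable => // i _; rewrite -[X in measurable X]setTI.
exact: measurable_mass.
Qed.

Lemma finite_partition_setX (I J : finType) (A : I -> set X) (B : J -> set X) :
  finite_partition A -> finite_partition B ->
  finite_partition (fun ij : I * J => A ij.1 `&` B ij.2).
Proof.
move=> [mA tA UA] [mB tB UB]; split.
- by move=> [i j]; exact: measurableI.
- move=> [i j] [i' j'] _ _ /= [x [[Ai Bj] [Ai' Bj']]].
  by congr pair; [apply: tA => //; exists x|apply: tB => //; exists x].
- apply/seteqP; split => // x _.
  have [i _ Ai] : (\bigcup_i A i) x by rewrite UA.
  have [j _ Bj] : (\bigcup_i B i) x by rewrite UB.
  by exists (i, j).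
Qed.

Lemma mass_setX_l (I J : finType) (A : I -> set X) (B : J -> set X) c i :
  finite_partition A -> finite_partition B ->
  mass c (A i) = \sum_(j : J) mass c (A i `&` B j).
Proof.
by move=> [mA _ _] [mB tB UB]; rewrite massE; exact: measure_finite_partition.
Qed.

Lemma mass_setX_r (I J : finType) (A : I -> set X) (B : J -> set X) c j :
  finite_partition A -> finite_partition B ->
  mass c (B j) = \sum_(i : I) mass c (A i `&` B j).
Proof.
move=> pA pB; rewrite (mass_setX_l c j pB pA).
by apply: eq_bigr => i _; rewrite setIC.
Qed.

Definition bool_partition (A : set X) (b : bool) : set X := if b then A else ~` A.

Lemma finite_partition_bool A : measurable A ->
  finite_partition (bool_partition A).
Proof.
move=> mA; split.
- by case => //=; exact: measurableC.
- by move=> [] [] _ _ // [x []].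
- by apply/seteqP; split => // x _; case: (pselect (A x)) => h; [exists true|exists false].
Qed.

(** Partitions are taken finer than a given [D], so that the number of points
    in [D] is a function of the numbers of points in the cells. *)
Definition refines (I : Type) (A : I -> set X) (D : set X) :=
  forall i, A i `<=` D \/ A i `<=` ~` D.

Definition cylinders (D : set X) : set (set N) :=
  [set B | exists (I : finType) (A : I -> set X) (C : set (I -> \bar R)),
    [/\ finite_partition A, refines A D &
        B = [set c | C (fun i => mass c (A i))]]].

(** Two partitions have a common refinement, indexed by the product. *)
Lemma cylinders_setI_closed D : setI_closed (cylinders D).
Proof.
move=> _ _ [I [A [C [pA rA ->]]]] [J [A' [C' [pA' rA' ->]]]].
exists (I * J)%type, (fun ij => A ij.1 `&` A' ij.2), [set f |
  C (fun i => \sum_(j : J) f (i, j)) /\ C' (fun j => \sum_(i : I) f (i, j))].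
split; first exact: finite_partition_setX.
  by move=> [i j]; have [h|h] := rA i; [left|right] => x [/h].
apply/seteqP; split => [c [/= h1 h2]|c [/= h1 h2]]; split => /=.
- by under eq_fun do rewrite -(mass_setX_l c _ pA pA').
- by under eq_fun do rewrite -(mass_setX_r c _ pA pA').
- by under eq_fun do rewrite (mass_setX_l c _ pA pA').
- by under eq_fun do rewrite (mass_setX_r c _ pA pA').
Qed.

Lemma evaluation_cylinders D : measurable D ->
  @evaluation_sets R S `<=` cylinders D.
Proof.
move=> mD _ [A [C [mA mC ->]]]; have pA := finite_partition_bool mA.
have pD := finite_partition_bool mD.
exists (bool * bool)%type,
  (fun ij => bool_partition A ij.1 `&` bool_partition D ij.2),
  [set f | C (\sum_(j : bool) f (true, j))].
split; first exact: finite_partition_setX.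
  by move=> [i []]; [left|right] => x [].
by apply/seteqP; split => c /=; rewrite -(mass_setX_l c true pA pD).
Qed.

Definition count_val (k : option nat) : \bar R :=
  if k is Some n then n%:R%:E else +oo.

Lemma count_val_inj : injective count_val.
Proof.
by move=> [m|] [n|] //= [] /eqP; rewrite eqr_nat => /eqP ->.
Qed.

Lemma mass_count_val (c : N) (A : set X) : exists k, mass c A = count_val k.
Proof.
by have [->|[n ->]] := mass_values c A; [exists None|exists (Some n)].
Qed.

(** Since counts lie in a countable set, a cylinder is a countable union of
    events that prescribe all the counts.  They are disjoint because [pickle_inv],
    unlike [unpickle], is injective where it is defined. *)
Definition cylinder_piece (I : finType) (A : I -> set X)
    (C : set (I -> \bar R)) (n : nat) : set N :=
  if @pickle_inv {ffun I -> option nat} n is Some k then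
    [set c | counts_are A (count_val \o k) c /\ C (count_val \o k)]
  else set0.

Lemma cylinder_pieceE (I : finType) (A : I -> set X) C n :
  cylinder_piece A C n = set0 \/
  exists k, cylinder_piece A C n = counts_are A k.
Proof.
rewrite /cylinder_piece; case: pickle_inv => [k|]; last by left.
have [Ck|Ck] := pselect (C (count_val \o k)); last first.
  by left; apply/seteqP; split => // c [].
by right; exists (count_val \o k); apply/seteqP; split => [c []|c].
Qed.

Lemma trivIset_cylinder_piece (I : finType) (A : I -> set X) C :
  trivIset setT (cylinder_piece A C).
Proof.
move=> m n _ _ [c []]; rewrite /cylinder_piece.
have := @pickle_invK {ffun I -> option nat} m.
have := @pickle_invK {ffun I -> option nat} n.
case: (pickle_inv n) => //= k <-; case: (pickle_inv m) => //= l <-.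
move=> [lc _] [kc _]; suff -> : k = l by [].
apply/ffunP => i; apply: count_val_inj.
by have := lc i; rewrite (kc i) => /= ->.
Qed.

Lemma cylinder_bigcup (I : finType) (A : I -> set X) C :
  [set c | C (fun i => mass c (A i))] = \bigcup_n cylinder_piece A C n.
Proof.
apply/seteqP; split => c /=.
  move=> Cc; pose k := [ffun i => projT1 (cid (mass_count_val c (A i)))].
  have kE : count_val \o k = fun i => mass c (A i).
    by apply/funext => i /=; rewrite /k ffunE; case: cid.
  exists (choice.pickle k) => //; rewrite /cylinder_piece pickleK_inv/= kE.
  by split => // i; rewrite kE.
move=> [n _]; rewrite /cylinder_piece; case: pickle_inv => // k [ck Ck].
by rewrite (_ : (fun i => _) = count_val \o k)//; apply/funext.
Qed.

Lemma measurable_cylinder D : cylinders D `<=` measurable.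
Proof.
move=> _ [I [A [C [[mA _ _] _ ->]]]]; rewrite cylinder_bigcup.
apply: bigcup_measurable => n _.
by have [->//|[k ->]] := cylinder_pieceE A C n; exact: measurable_counts_are.
Qed.

(** Cylinders are stable under intersection and generate the sigma-algebra, and
    each of them is a countable disjoint union of events of the form
    [counts_are A k]. *)
Lemma point_measures_unique (D : set X) (m1 m2 : {measure set N -> \bar R}) :
  measurable D -> m1 setT < +oo ->
  (forall (I : finType) (A : I -> set X) k, finite_partition A ->
    refines A D -> m1 (counts_are A k) = m2 (counts_are A k)) ->
  forall B, measurable B -> m1 B = m2 B.
Proof.
move=> mD m1T m12; apply: (finite_measure_unique (G := cylinders D)) => //.
- apply/seteqP; split.
    apply: smallest_sub; first exact: smallest_sigma_algebra.
    by move=> B eB; apply: sub_sigma_algebra; exact: evaluation_cylinders.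
  apply: smallest_sub; first exact: sigma_algebra_measurable.
  exact: measurable_cylinder.
- exact: cylinders_setI_closed.
- exists bool, (bool_partition D), setT; split => //.
    exact: finite_partition_bool.
  by case; [left|right].
- move=> _ [I [A [C [pA rA ->]]]]; rewrite cylinder_bigcup.
  have mp n : measurable (cylinder_piece A C n).
    have [->//|[k ->]] := cylinder_pieceE A C n.
    by apply: measurable_counts_are; case: pA.
  rewrite !measure_bigcup//; [|exact: trivIset_cylinder_piece..].
  apply: eq_eseriesr => n _.
  by have [->|[k ->]] := cylinder_pieceE A C n; rewrite ?measure0 ?m12.
Qed.

End cylinders.

(** * Image measures *)

Section image_measures.
Context (R : realType) d d' (T : measurableType d) (E : measurableType d').
Local Open Scope ereal_scope.

(** The measurability of [f] is an argument so that the structure of measure can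
    be inferred. *)
Definition image_measure (m : set T -> \bar R) (f : T -> E)
  (mf : measurable_fun setT f) : set E -> \bar R := fun A => m (f @^-1` A).

Section measure.
Variables (m : {measure set T -> \bar R}) (f : T -> E).
Variable mf : measurable_fun setT f.

Let mpre A : measurable A -> measurable (f @^-1` A).
Proof. by move=> mA; rewrite -[X in measurable X]setTI; exact: mf. Qed.

Let image0 : image_measure m mf set0 = 0. Proof. by rewrite /image_measure preimage_set0. Qed.

Let image_ge0 A : 0 <= image_measure m mf A. Proof. exact: measure_ge0. Qed.

Let image_sigma_additive : semi_sigma_additive (image_measure m mf).
Proof.
move=> F mF tF mUF; rewrite /image_measure preimage_bigcup.
apply: measure_semi_sigma_additive.
- by move=> n; exact: mpre.
- by move=> i j _ _ [x [Fi Fj]]; apply: tF => //; exists (f x).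
- by rewrite -preimage_bigcup; exact: mpre.
Qed.

HB.instance Definition _ := isMeasure.Build _ _ _ (image_measure m mf)
  image0 image_ge0 image_sigma_additive.

End measure.

Variables (P : probability T R) (f : T -> E) (mf : measurable_fun setT f).

Let image_setT : image_measure P mf setT = 1.
Proof. by rewrite /image_measure preimage_setT probability_setT. Qed.

HB.instance Definition _ :=
  Measure_isProbability.Build _ _ _ (image_measure P mf) image_setT.

Lemma measurable_preimage A : measurable A -> measurable (f @^-1` A).
Proof. by move=> mA; rewrite -[X in measurable X]setTI; exact: mf. Qed.

Lemma ge0_integral_image (m : {measure set T -> \bar R}) (h : E -> \bar R) D :
  measurable D -> measurable_fun D h -> (forall y, 0 <= h y) ->
  \int[image_measure m mf]_(y in D) h y = \int[m]_(x in f @^-1` D) h (f x).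
Proof.
by move=> mD mh h0; apply: (ge0_integral_pushforward mf) => // y _; exact: h0.
Qed.

End image_measures.

(** * The law of the counts of a Poisson process *)

Section poisson_law.
Context (R : realType) (S : ptopologicalType).
Local Notation X := (point_space R S).
Local Notation N := (point_measures R S).
Variable nu : {measure set X -> \bar R}.
Local Open Scope ereal_scope.

(** The parameter [l] and the value [k] may be infinite, and [k] need not be an
    integer. *)
Definition poisson_mass (l : \bar R) (k : \bar R) : \bar R :=
  if l is r%:E then poisson_prob r 0%N [set n | n%:R%:E = k]
  else if k == +oo then 1 else 0.

Section process.
Context d (T : measurableType d) (P : probability T R) (eta : T -> N).
Hypothesis eta_poisson : poisson_point_process P nu eta.

Let meta : measurable_fun setT eta. Proof. by case: eta_poisson. Qed.

Let mevent (A : set X) k : measurable A -> measurable [set w | mass (eta w) A = k].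
Proof.
move=> mA; rewrite -[X in measurable X]setTI.
exact: (measurable_mass_comp meta mA measurableT (emeasurable_set1 k)).
Qed.

(** The values that are not integers have probability zero because the Poisson
    weights sum to one. *)
Lemma poisson_process_mass (A : set X) k : measurable A ->
  P [set w | mass (eta w) A = k] = poisson_mass (nu A) k.
Proof.
move=> mA; have [_ fin inf _] := eta_poisson.
have nu0 : 0 <= nu A by [].
case: (nu A) nu0 (fin A mA) (inf A mA) => [r| |//] r0 /= {}fin {}inf.
- have {}fin n := fin (ltry _) n.
  have [[n kn]|kn] := pselect (exists n : nat, n%:R%:E = k).
    rewrite -kn fin; congr poisson_prob; apply/seteqP; split => [m /= -> //|m /=].
    by move=> /eqP; rewrite eqe eqr_nat => /eqP.
  rewrite [X in poisson_prob _ _ X](_ : _ = set0) ?measure0; last first.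
    by apply/seteqP; split => // n /= h; apply: kn; exists n.
  apply/eqP; rewrite eq_le measure_ge0 andbT.
  pose F n := [set w | mass (eta w) A = n%:R%:E].
  have mF n : measurable (F n) by exact: mevent.
  have tF : trivIset setT F.
    move=> m n _ _ [w []]; rewrite /F /= => ->.
    by move=> /eqP; rewrite eqe eqr_nat => /eqP.
  have F1 : P (\bigcup_n F n) = 1.
    have <- : poisson_prob r 0%N (\bigcup_n [set n]) = 1.
      rewrite (_ : \bigcup_n [set n] = setT) ?probability_setT//.
      by apply/seteqP; split => // n _; exists n.
    rewrite !measure_bigcup//; first by apply: eq_eseriesr => n _; exact: fin.
    by move=> i j _ _ [x [-> ->]].
  have <- : P (~` (\bigcup_n F n)) = 0.
    by rewrite probability_setC ?F1 ?subee//; exact: bigcup_measurable.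
  apply: le_measure; first exact/mem_set/mevent.
    by apply/mem_set/measurableC; exact: bigcup_measurable.
  by move=> w /= wk [n _ Fw]; apply: kn; exists n; rewrite -wk Fw.
- have {}inf := inf erefl.
  have [->//|/eqP koo] := eqVneq k +oo.
  apply/eqP; rewrite eq_le measure_ge0 andbT.
  have <- : P (~` [set w | mass (eta w) A = +oo]) = 0.
    by rewrite probability_setC ?inf ?subee//; exact: mevent.
  apply: le_measure; first exact/mem_set/mevent.
    by apply/mem_set/measurableC; exact: mevent.
  by move=> w /= ->.
Qed.

Lemma poisson_process_counts (I : finType) (A : I -> set X) k :
  (forall i, measurable (A i)) -> trivIset setT A ->
  P (eta @^-1` counts_are A k) = \prod_(i : I) poisson_mass (nu (A i)) (k i).
Proof.
move=> mA tA; have [_ _ _ ind] := eta_poisson.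
have tA' : trivIset setT (A \o @enum_val I predT).
  by move=> i j _ _ h; apply: enum_val_inj; exact: tA.
have := @ind #|I| (A \o @enum_val I predT)
  (fun i => [set k (enum_val i)]) (fun i => mA _).
move=> /(_ (fun i => emeasurable_set1 _) tA').
rewrite (_ : \bigcap_i _ = eta @^-1` counts_are A k); last first.
  apply/seteqP; split => [w h i|w h i _] /=; last exact: h.
  by have := h (enum_rank i) Logic.I; rewrite /= enum_rankK.
move=> ->; rewrite [RHS](eq_bigl (fun i => i \in I))// [RHS]big_enum_val /=.
by apply: eq_bigr => i _; exact: poisson_process_mass.
Qed.

End process.

End poisson_law.

(** * Joint laws and rectangles *)

Section joint_laws.
Context (R : realType) d d' (T : measurableType d) (T' : measurableType d').
Context e1 e2 (E1 : measurableType e1) (E2 : measurableType e2).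
Local Open Scope ereal_scope.

Lemma joint_law_rectangles (P : probability T R) (P' : probability T' R)
    (X : T -> E1) (Y : T -> E2) (X' : T' -> E1) (Y' : T' -> E2) (F : set T)
    (k : \bar R) :
  measurable_fun setT X -> measurable_fun setT Y ->
  measurable_fun setT X' -> measurable_fun setT Y' ->
  measurable F -> 0 <= k -> k \is a fin_num ->
  (forall A B, measurable A -> measurable B ->
    P (X @^-1` A `&` Y @^-1` B `&` F) = P' (X' @^-1` A `&` Y' @^-1` B) * k) ->
  forall W, measurable W ->
    P ((fun w => (X w, Y w)) @^-1` W `&` F) = P' ((fun w => (X' w, Y' w)) @^-1` W) * k.
Proof.
move=> mX mY mX' mY' mF k0 fk rect W mW.
have fk0 : (0 <= fine k)%R by rewrite fine_ge0.
rewrite -(fineK fk) muleC; move: W mW.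
apply: (@finite_measure_unique_rectangles R _ _ E1 E2
  (image_measure (mrestr P mF) (measurable_fun_pair mX mY))
  (mscale (NngNum fk0) (image_measure P' (measurable_fun_pair mX' mY')))) => //.
  rewrite /= /image_measure /mrestr preimage_setT setTI.
  by rewrite -ge0_fin_numE// fin_num_measure.
move=> A B mA mB; rewrite /= /image_measure /mrestr /mscale /= fineK// muleC.
exact: rect.
Qed.

End joint_laws.

(** * Locally finite configurations *)

Section regular.
Context (R : realType) (S : ptopologicalType).
Local Notation X := (point_space R S).
Local Notation N := (point_measures R S).
Variable K : nat -> set X.
Hypothesis mK : forall n, measurable (K n).
Local Open Scope ereal_scope.

(** The exhausting sequence [K] plays the role of the compact sets. *)
Definition regular (c : N) := forall n, mass c (K n) < +oo.

(** The mass of a section depends measurably on a configuration only when the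
    latter is locally finite; discarding the other configurations gives functions
    that are measurable on the whole space of point measures. *)
Definition regularize (c : N) : N :=
  if `[< regular c >] then c else PointFamily set0 (fun=> (point, 0%R)).

Lemma regularize_id c : regular c -> regularize c = c.
Proof. by move=> rc; rewrite /regularize asboolT. Qed.

Lemma regular_regularize c : regular (regularize c).
Proof.
rewrite /regularize; case: ifPn => [/asboolP//|_ n].
by rewrite (mass_eq0 _ _).2.
Qed.

Lemma measurable_regular : measurable (regular : set N).
Proof.
rewrite (_ : regular = \bigcap_n ((fun c => mass c (K n)) @^-1` [set~ +oo])).
  apply: bigcap_measurable => // n _; rewrite -[X in measurable X]setTI.
  apply: measurable_mass => //; apply: measurableC; exact: emeasurable_set1.
apply/seteqP; split => c /= h n; first by move=> _; apply/eqP; rewrite -ltey.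
by have /eqP := h n Logic.I; rewrite -ltey.
Qed.

Lemma measurable_regularize : measurable_fun setT regularize.
Proof.
apply: measurable_fun_if => //.
apply: (@measurable_fun_bool _ _ _ _ true); rewrite setTI.
rewrite (_ : _ @^-1` _ = (regular : set N)); first exact: measurable_regular.
by apply/seteqP; split => c /=; move/asboolP.
Qed.

End regular.

(** * Mecke's formula *)

Section add_point.
Context (R : realType) (S : ptopologicalType).
Local Notation X := (point_space R S).
Local Notation N := (point_measures R S).
Local Open Scope ereal_scope.

Definition add_point (c : N) (p : X) : N :=
  PointFamily [set i | if i is j.+1 then pindex c j else True]
    (fun i => if i is j.+1 then patom c j else p).

Lemma mass_add_point c p (A : set X) :
  mass (add_point c p) A = mass c A + (\1_A p)%:E.
Proof.
rewrite !mass_counting !counting_dirac nneseries_recl//.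
rewrite addeC; congr (_ + _).
  rewrite -[LHS]nneseries_addn//; apply: eq_eseriesr => i _.
  by rewrite addn1 !diracE; congr (_%:R%:E); rewrite !in_setI.
rewrite diracE indicE; congr ((_ : bool)%:R%:E).
by apply/idP/idP => /set_mem h; apply/mem_set; [case: h|split].
Qed.

Lemma measurable_add_point :
  measurable_fun setT (fun cp : N * X => add_point cp.1 cp.2).
Proof.
apply: measurable_to_point_measures => A mA.
under eq_fun do rewrite mass_add_point; apply: emeasurable_funD.
  exact: (measurable_mass_comp measurable_fst).
apply/measurable_EFinP.
rewrite (_ : (fun cp => _) = mindic R mA \o snd)//.
exact: measurableT_comp.
Qed.

Lemma counts_are_add_point (I : eqType) (A : I -> set X) k c p i :
  trivIset setT A -> A i p ->
  counts_are A k (add_point c p) <->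
  counts_are A (fun j => k j - (j == i)%:R%:E) c.
Proof.
move=> tA Ap; suff h j : mass (add_point c p) (A j) = k j <->
    mass c (A j) = k j - (j == i)%:R%:E.
  by split => hc j; apply/h; exact: hc.
have -> : (j == i)%:R%:E = (\1_(A j) p)%:E :> \bar R.
  rewrite indicE; have [->|ji] := eqVneq j i; first by rewrite mem_set.
  by rewrite memNset// => Aj; move/eqP : ji; apply; apply: tA => //; exists p.
rewrite mass_add_point; split => [<-|->]; first by rewrite addeK.
by rewrite subeK.
Qed.

End add_point.

(** The identity of Poisson weights on which Mecke's formula rests. *)
Lemma poisson_mass_pred (R : realType) (l k : \bar R) :
  (0 <= l)%E -> (l < +oo)%E ->
  (l * poisson_mass l (k - 1) = k * poisson_mass l k)%E.
Proof.
case: l => // r; rewrite lee_fin => r0 _; rewrite /poisson_mass.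
have set_pred : [set n | n%:R%:E = (k - 1)%E] =
    [set n | n.+1%:R%:E = k] :> set nat.
  apply/seteqP; split => n /=.
    move=> nk; rewrite -[RHS](@subeK _ _ 1%E)// -nk -EFinD; congr (_%:E).
    by rewrite -natr1.
  by move=> <-; rewrite -EFinB -natr1 addrK.
rewrite set_pred.
have [[n kn]|kn] := pselect (exists n : nat, n%:R%:E = k); last first.
  rewrite (_ : [set n | n.+1%:R%:E = k] = set0).
    rewrite (_ : [set n | n%:R%:E = k] = set0) ?measure0 ?mule0//.
    by apply/seteqP; split => // n h; apply: kn; exists n.
  by apply/seteqP; split => // n h; apply: kn; exists n.+1.
have set1n : [set m | m%:R%:E = k] = [set n].
  rewrite -kn; apply/seteqP; split => m /= => [|->//].
  by move=> /eqP; rewrite eqe eqr_nat => /eqP.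
rewrite set1n -kn; case: n kn set1n => [|n] kn set1n.
  rewrite mul0e (_ : [set n | n.+1%:R%:E = 0%:R%:E] = set0) ?measure0 ?mule0//.
  by apply/seteqP; split => // m /= [] /eqP; rewrite pnatr_eq0.
rewrite (_ : [set m | m.+1%:R%:E = n.+1%:R%:E] = [set n]); last first.
  apply/seteqP; split => m /= => [|->//].
  by move=> /eqP; rewrite eqe eqr_nat => /eqP[].
rewrite /poisson_prob; move: r0; rewrite le_eqVlt => /predU1P[<-|r0].
  by rewrite ltxx mul0e diracE memNset ?mule0.
rewrite r0 !esum_set1 ?lee_fin ?poisson_pmf_ge0//.
rewrite -!EFinM /poisson_pmf r0; congr (_%:E).
rewrite factS natrM exprS; field.
by rewrite nat1r !pnatr_eq0 -lt0n fact_gt0.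
Qed.

Section mecke.
Context (R : realType) (S : ptopologicalType).
Local Notation X := (point_space R S).
Local Notation N := (point_measures R S).
Variable nu : {sigma_finite_measure set X -> \bar R}.
Variable K : nat -> set X.
Hypothesis mK : forall n, measurable (K n).
Hypothesis ndK : nondecreasing_seq K.
Hypothesis UK : \bigcup_n K n = setT.
Hypothesis nuK : forall n, (nu (K n) < +oo)%E.
Variable L : probability N R.
Hypothesis L_poisson : poisson_point_process L nu id.
Local Open Scope ereal_scope.

Lemma poisson_mass_infinite A : measurable A -> nu A < +oo ->
  L [set c | mass c A = +oo] = 0.
Proof.
move=> mA nuA; rewrite (poisson_process_mass L_poisson)//.
move: nuA; have : 0 <= nu A by []; rewrite /poisson_mass /=.
case: (nu A) => //= r _ _; rewrite (_ : [set _ | _] = set0) ?measure0//.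
by apply/seteqP; split.
Qed.

(** A Poisson variable of finite parameter is finite almost surely. *)
Lemma poisson_regular : L (~` regular K) = 0.
Proof.
apply/eqP; rewrite eq_le measure_ge0 andbT.
pose F n := [set c : N | mass c (K n) = +oo].
have mF n : measurable (F n).
  rewrite -[X in measurable X]setTI.
  exact: (measurable_mass (mK n) measurableT (emeasurable_set1 +oo)).
apply: (@le_trans _ _ (L (\bigcup_n F n))).
  apply: le_measure; first by apply/mem_set; apply: measurableC; exact: measurable_regular.
    by apply/mem_set; exact: bigcup_measurable.
  move=> c /= /existsNP[n]; rewrite ltey => /negP/negPn/eqP cn.
  by exists n.
have := measure_sigma_subadditive L mF (bigcup_measurable (fun n _ => mF n))
  (@subset_refl _ (\bigcup_n F n)).
move=> h; apply: (le_trans h).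
by rewrite eseries0// => n _ _; exact: poisson_mass_infinite.
Qed.

Lemma measurable_regularize_xsection d (T : measurableType d)
    (c : T -> N) (W : set (T * X)) : measurable_fun setT c -> measurable W ->
  measurable_fun setT (fun x => mass (regularize K (c x)) (xsection W x)).
Proof.
move=> mc; apply: (measurable_mass_xsection (c := regularize K \o c)) => //.
- by apply: measurableT_comp => //; exact: measurable_regularize.
- by move=> x n; exact: regular_regularize.
Qed.

(** The Campbell measure of [L]: the expected number of points [p] of the
    configuration [c] such that [(c, p)] is in [W]. *)
Definition campbell (W : set (N * X)) : \bar R :=
  \int[L]_c mass (regularize K c) (xsection W c).

Let campbell0 : campbell set0 = 0.
Proof.
rewrite /campbell; under eq_integral do rewrite xsection0 massE measure0.
by rewrite integral0.
Qed.

Let campbell_ge0 W : 0 <= campbell W.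
Proof. by apply: integral_ge0 => c _; rewrite massE. Qed.

Let campbell_sigma_additive : semi_sigma_additive campbell.
Proof.
move=> F mF tF mUF; rewrite /campbell.
rewrite (_ : (fun c => _) = (fun c => \sum_(n <oo)
    mass (regularize K c) (xsection (F n) c))); last first.
  apply/funext => c; rewrite xsection_bigcup massE measure_bigcup//.
  - by apply: eq_eseriesl => n; rewrite in_setT.
  - by move=> n _; exact: measurable_xsection.
  - exact: trivIset_xsection.
rewrite integral_nneseries//; last 2 first.
- by move=> n; apply: measurable_regularize_xsection => //; exact: measurable_id.
- by move=> n c _; rewrite massE.
apply: is_cvg_nneseries => n _ _.
by apply: integral_ge0 => c _; rewrite massE.
Qed.

HB.instance Definition _ := isMeasure.Build _ _ _ campbell
  campbell0 campbell_ge0 campbell_sigma_additive.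

(** On the event [counts_are A k] there are [k i] points in [A i]. *)
Lemma campbell_counts (I : finType) (A : I -> set X) k i :
  finite_partition A -> nu (A i) < +oo ->
  campbell (counts_are A k `*` A i) = k i * L (counts_are A k).
Proof.
move=> [mA tA UA] nuA; have mE := measurable_counts_are k mA.
rewrite /campbell -integral_cst// [RHS]integral_mkcond.
have mW : measurable (counts_are A k `*` A i) by exact: measurableX.
apply: ae_eq_integral => //.
- by apply: measurable_regularize_xsection => //; exact: measurable_id.
- by apply/measurable_restrict => //; exact: measurable_cst.
exists (~` regular K); split; [|exact: poisson_regular|].
  by apply: measurableC; exact: measurable_regular.
move=> c /= h rc; apply: h => _; rewrite regularize_id// patchE.
have [cE|cE] := boolP (c \in counts_are A k).
  by rewrite in_xsectionX//; move/set_mem : cE => ->.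
by rewrite notin_xsectionX// massE measure0.
Qed.

(** The right-hand side of Mecke's formula: the law of a configuration to which
    an independent point of intensity [nu] is added, with that point. *)
Definition mecke_measure : set (N * X) -> \bar R :=
  image_measure (L \x nu)
    (measurable_fun_pair (@measurable_add_point R S) measurable_snd).
HB.instance Definition _ := Measure.on mecke_measure.

Let product_setTX (A : set X) : measurable A ->
  (L \x nu) (setT `*` A) = nu A.
Proof.
move=> mA; rewrite product_measure1E//; transitivity (1 * nu A).
  by congr (_ * _); exact: probability_setT.
by rewrite mul1e.
Qed.

(** A point added in [A i] raises the count of this cell only; the shift of its
    count by one is absorbed by [poisson_mass_pred]. *)
Lemma mecke_counts (I : finType) (A : I -> set X) k i :
  finite_partition A -> nu (A i) < +oo ->
  mecke_measure (counts_are A k `*` A i) = k i * L (counts_are A k).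
Proof.
move=> [mA tA UA] nuA; rewrite /mecke_measure /image_measure.
rewrite (_ : _ @^-1` _ =
    counts_are A (fun j => k j - (j == i)%:R%:E) `*` A i); last first.
  apply/seteqP; split => -[c p] /= [h Ap]; split => //.
    exact/(counts_are_add_point k c tA Ap).
  exact/(counts_are_add_point k c tA Ap).
rewrite product_measure1E//; last exact: measurable_counts_are.
have Lcounts k' : L (counts_are A k') = \prod_j poisson_mass (nu (A j)) (k' j).
  exact: (poisson_process_counts L_poisson k' mA tA).
rewrite Lcounts; transitivity
    ((\prod_j poisson_mass (nu (A j)) (k j - (j == i)%:R%:E)) * nu (A i)).
  by congr (_ * _); exact: Lcounts.
rewrite (bigD1 i)//= [in RHS](bigD1 i)//= eqxx.
rewrite [X in _ * X * _](eq_bigr (fun j => poisson_mass (nu (A j)) (k j))).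
  by rewrite muleC !muleA poisson_mass_pred.
by move=> j /negPf ->; rewrite sube0.
Qed.

(** The two lemmas above give the equality on the rectangles whose sides are an
    event prescribing counts and a cell of the corresponding partition; a
    partition finer than [A] is used to write [A] as a union of cells. *)
Lemma mecke_rectangle (A : set X) (B : set N) : measurable A -> nu A < +oo ->
  measurable B -> campbell (B `*` A) = mecke_measure (B `*` A).
Proof.
move=> mA nuA; have mTA : measurable ([set: N] `*` A) by exact: measurableX.
pose slice (m : {measure set (N * X) -> \bar R}) :=
  image_measure (mrestr m mTA) (@measurable_fst _ _ N X).
have sliceE (m : {measure set (N * X) -> \bar R}) (C : set N) :
    slice m C = m (C `*` A).
  rewrite /slice /image_measure /= /mrestr; congr (m _).
  by apply/seteqP; split => -[c p] /= [] // ? [].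
have counts (I : finType) (P : I -> set X) k : finite_partition P ->
    refines P A -> slice campbell (counts_are P k) =
    slice mecke_measure (counts_are P k).
  move=> pP rP; rewrite !sliceE; have [mP tP UP] := pP.
  have split_rect (m : {measure set (N * X) -> \bar R}) :
      m (counts_are P k `*` A) = \sum_i m (counts_are P k `*` (A `&` P i)).
    rewrite (@measure_finite_partition _ _ _ I _ _ (fun i => [set: N] `*` P i)).
    - by apply: eq_bigr => i _; rewrite -setXI setIT.
    - by apply: measurableX => //; exact: measurable_counts_are.
    - by move=> i; exact: measurableX.
    - by move=> i j _ _ [[c p] [[_ Pi] [_ Pj]]]; apply: tP => //; exists p.
    - apply/seteqP; split => // -[c p] _.
      have [i _ Pi] : (\bigcup_i P i) p by rewrite UP.
      by exists i.
  rewrite !split_rect; apply: eq_bigr => i _.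
  have [PA|PA] := rP i; last first.
    rewrite (_ : A `&` P i = set0) ?setX0 ?measure0//.
    by apply/seteqP; split => // p [Ap /PA].
  have nuP : nu (P i) < +oo.
    by apply: (le_lt_trans _ nuA); apply: le_measure => //; exact/mem_set.
  rewrite (setIidr PA); transitivity (k i * L (counts_are P k)).
    exact: campbell_counts.
  by apply/esym; exact: mecke_counts.
move=> mB; rewrite -!sliceE; apply/esym; move: B mB.
apply: (@point_measures_unique R S A (slice mecke_measure) (slice campbell)) => //.
  have h : mecke_measure (setT `*` A) < +oo.
    rewrite /mecke_measure /image_measure.
    rewrite (_ : _ @^-1` _ = setT `*` A); last by apply/seteqP; split => -[c p].
    by rewrite product_setTX.
  by rewrite (le_lt_trans _ h)// -(sliceE mecke_measure).
by move=> I P k pP rP; apply/esym; exact: counts.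
Qed.

(** Both sides are measures, finite on the sets [setT `*` K n], where they agree
    on rectangles. *)
Theorem mecke_formula (W : set (N * X)) : measurable W ->
  campbell W = mecke_measure W.
Proof.
move=> mW; pose TK n := [set: N] `*` K n.
have mTK n : measurable (TK n) by exact: measurableX.
apply: (@measure_eq_exhaustion _ _ _ _ _ TK) => //.
- move=> m n mn; apply/subsetPset => -[c p] [_ Kp]; split => //.
  by move: Kp; exact/subsetPset/ndK.
- apply/seteqP; split => // -[c p] _.
  by have [n _ Kp] : (\bigcup_n K n) p by [rewrite UK]; exists n.
move=> n; have mKn : measurable (K n) := mK n.
apply/esym; apply: (@finite_measure_unique_rectangles R _ _ N X
  (mrestr mecke_measure (mTK n)) (mrestr campbell (mTK n))) => // [|B A mB mA].
  rewrite /= /mrestr setTI /mecke_measure /image_measure.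
  rewrite (_ : _ @^-1` _ = setT `*` K n); last by apply/seteqP; split => -[c p].
  by rewrite product_setTX.
rewrite /= /mrestr /TK -setXI setIT mecke_rectangle//; first exact: measurableI.
apply: (le_lt_trans _ (nuK n)); apply: le_measure => //.
  by apply/mem_set; exact: measurableI.
exact/mem_set.
Qed.

End mecke.

(** * Lebesgue measure under affine maps *)

Section lebesgue_affine.
Context (R : realType).
Local Notation leb := (@lebesgue_measure R).
Local Open Scope ereal_scope.

Let shift_measurable (a : R) : measurable_fun setT
  ((fun v => v - a)%R : measurableTypeR R -> measurableTypeR R).
Proof. exact: measurable_funB. Qed.

Lemma lebesgue_measure_shift (a : R) (A : set (measurableTypeR R)) :
  measurable A -> leb ((fun v => v - a)%R @^-1` A) = leb A.
Proof.
move=> mA; apply/esym.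
apply: (@lebesgue_measure_unique R (image_measure leb (shift_measurable a))) => //.
move=> _ [[x y] _ <-]; rewrite /= /image_measure.
rewrite (_ : _ @^-1` _ = `](x + a)%R, (y + a)%R]%classic); last first.
  by apply/seteqP; split => v /=; rewrite !in_itv/= ltrBrDr lerBlDr.
by rewrite !lebesgue_measure_itv/= !lte_fin ltrD2r -!EFinD opprD addrACA subrr addr0.
Qed.

Let scale_measurable (a : R) : measurable_fun setT
  ((fun v => v / a)%R : measurableTypeR R -> measurableTypeR R).
Proof. exact: measurable_funM. Qed.

Lemma lebesgue_measure_scale (a : R) (A : set (measurableTypeR R)) : (0 < a)%R ->
  measurable A -> leb ((fun v => v / a)%R @^-1` A) = a%:E * leb A.
Proof.
move=> a0 mA; have ai0 : (0 <= a^-1)%R by rewrite invr_ge0 ltW.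
suff -> : leb A = a^-1%:E * leb ((fun v => v / a)%R @^-1` A).
  by rewrite muleA -EFinM divff ?gt_eqF// mul1e.
apply: (@lebesgue_measure_unique R (mscale (NngNum ai0)
  (image_measure leb (scale_measurable a)))) => //.
move=> _ [[x y] _ <-]; rewrite /= /mscale /= /image_measure.
rewrite (_ : _ @^-1` _ = `](x * a)%R, (y * a)%R]%classic); last first.
  by apply/seteqP; split => v /=; rewrite !in_itv/= ltr_pdivlMr// ler_pdivrMr.
rewrite !lebesgue_measure_itv/= !lte_fin ltr_pM2r//; case: ifPn => _.
  by rewrite -!EFinD -EFinM -mulrBl mulrC mulfK// gt_eqF.
by rewrite mule0.
Qed.

Lemma ge0_integral_scale (a : R) (phi : R -> \bar R) : (0 < a)%R ->
  measurable_fun setT (phi : measurableTypeR R -> \bar R) -> (forall v, 0 <= phi v) ->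
  \int[leb]_v phi (v / a)%R = a%:E * \int[leb]_v phi v.
Proof.
move=> a0 mphi phi0.
rewrite -(@ge0_integral_mscale _ _ _ _ _ _ (NngNum (ltW a0)))//.
have := @ge0_integral_pushforward _ _ _ _ R _ (scale_measurable a) leb setT phi
  measurableT mphi (fun v _ => phi0 v).
rewrite preimage_setT => <-; apply: eq_measure_integral => A mA _.
exact: lebesgue_measure_scale.
Qed.

End lebesgue_affine.

(** * Configurations seen from a growing graph *)

Section reduce.
Context (R : realType) (S : ptopologicalType).
Local Notation X := (point_space R S).
Local Notation N := (point_measures R S).
Implicit Types (G : borel S -> R) (c : N).
Local Open Scope ereal_scope.

Definition below G : set X := [set p | (p.2 <= G p.1)%R].

Definition lower G (p : X) : X := (p.1, (p.2 - G p.1)%R).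

(** One construction covers both [strip] and the residual processes of the
    exploration, which differ by the set [D] of the points that are kept. *)
Definition reduce (D : set X) G c : N :=
  PointFamily (pindex c `&` patom c @^-1` D) (fun i => lower G (patom c i)).

Lemma mass_reduce D G c (A : set X) :
  mass (reduce D G c) A = mass c (D `&` lower G @^-1` A).
Proof. by rewrite !mass_counting -setIA. Qed.

(** What is left of a configuration once the graph has grown up to [G]. *)
Definition strip G := reduce (~` below G) G.

Section measurability.
Context d (T : measurableType d) (G : T -> borel S -> R).
Hypothesis mG : measurable_fun setT (fun q : T * borel S => G q.1 q.2).

Lemma measurable_lower :
  measurable_fun setT (fun q : T * X => lower (G q.1) q.2).
Proof.
apply: measurable_fun_pair; first exact: measurableT_comp.
apply: measurable_funB; first exact: measurableT_comp.
apply: (measurableT_comp mG (g := fun q : T * X => (q.1, q.2.1))).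
by apply: measurable_fun_pair => //; exact: measurableT_comp.
Qed.

Lemma measurable_below : measurable [set q : T * X | below (G q.1) q.2].
Proof.
have -> : [set q : T * X | below (G q.1) q.2] =
    [set q | ((lower (G q.1) q.2).2 <= 0)%R].
  by apply/seteqP; split => q /=; rewrite /below/= subr_le0.
rewrite -[X in measurable X]setTI; apply: measurable_fun_le => //.
apply: (measurableT_comp measurable_snd); exact: measurable_lower.
Qed.

Variable K : nat -> set X.
Hypothesis mK : forall n, measurable (K n).
Hypothesis ndK : nondecreasing_seq K.
Hypothesis UK : \bigcup_n K n = setT.
Variable c : T -> N.
Hypothesis mc : measurable_fun setT c.
Hypothesis rc : forall x, regular K (c x).

Lemma measurable_reduce (D : T -> set X) :
  measurable [set q : T * X | D q.1 q.2] ->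
  measurable_fun setT (fun x => reduce (D x) (G x) (c x)).
Proof.
move=> mD; apply: measurable_to_point_measures => A mA.
under eq_fun do rewrite mass_reduce.
pose W := [set q : T * X | D q.1 q.2] `&`
  (fun q : T * X => lower (G q.1) q.2) @^-1` A.
have mW : measurable W.
  by apply: measurableI => //; exact: (measurable_preimage measurable_lower).
rewrite (_ : (fun x => _) = fun x => mass (c x) (xsection W x)).
  exact: measurable_mass_xsection.
by apply/funext => x; rewrite xsectionE.
Qed.

Lemma measurable_strip : measurable_fun setT (fun x => strip (G x) (c x)).
Proof.
by apply: measurable_reduce; apply: measurableC; exact: measurable_below.
Qed.

Lemma measurable_mass_below :
  measurable_fun setT (fun x => mass (c x) (below (G x))).
Proof.
have := measurable_mass_xsection mc mK ndK UK rc measurable_below.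
congr measurable_fun; apply/funext => x; by rewrite xsectionE.
Qed.

End measurability.

Lemma measurable_lower1 G : measurable_fun setT G ->
  measurable_fun setT (lower G).
Proof.
move=> mG; apply: measurable_fun_pair; first exact: measurable_fst.
by apply: measurable_funB => //; exact: measurableT_comp.
Qed.

Lemma measurable_below1 G : measurable_fun setT G -> measurable (below G).
Proof.
move=> mG; rewrite -[X in measurable X]setTI; apply: measurable_fun_le => //.
exact: measurableT_comp.
Qed.

Lemma measurable_strip1 G : measurable_fun setT G ->
  measurable_fun setT (strip G).
Proof.
move=> mG; apply: measurable_to_point_measures => A mA.
under eq_fun do rewrite mass_reduce; apply: measurable_mass.
apply: measurableI; first by apply: measurableC; exact: measurable_below1.
by apply: (measurable_preimage (measurable_lower1 mG)).
Qed.

End reduce.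

(** * The intensity measure and its invariance *)

Section slab.
Context (R : realType) (S : ptopologicalType).
Local Notation X := (point_space R S).
Variable U : nat -> set (borel S).
Hypothesis mU : forall n, measurable (U n).
Hypothesis ndU : nondecreasing_seq U.
Hypothesis UU : \bigcup_n U n = setT.
Local Open Scope ereal_scope.

Definition slab n : set X := U n `*` `[(- n%:R)%R, n%:R].

Lemma measurable_slab n : measurable (slab n).
Proof. exact: measurableX. Qed.

Lemma nondecreasing_slab : nondecreasing_seq slab.
Proof.
move=> m n mn; apply/subsetPset => -[x v] [/= Ux]; rewrite !in_itv/= => /andP[mv vm].
split; first by move: Ux; apply/subsetPset; exact: ndU.
have mnR : (m%:R <= n%:R :> R)%R by rewrite ler_nat.
by rewrite /= in_itv/= (le_trans _ mv) ?lerN2//= (le_trans vm).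
Qed.

Lemma bigcup_slab : \bigcup_n slab n = setT.
Proof.
apply/seteqP; split => // -[x v] _.
have [n _ Ux] : (\bigcup_n U n) x by rewrite UU.
pose m := (Num.truncn `|v|).+1; exists (maxn n m) => //; split => /=.
  by move: Ux; apply/subsetPset; apply: ndU; exact: leq_maxl.
rewrite in_itv/= -ler_norml (le_trans (ltW (truncnS_gt _)))//.
by rewrite ler_nat leq_maxr.
Qed.

End slab.

Section intensity.
Context (R : realType) (S : ptopologicalType).
Local Notation X := (point_space R S).
Local Notation N := (point_measures R S).
Variable mu : {sigma_finite_measure set (borel S) -> \bar R}.
Local Notation leb := (@lebesgue_measure R).
Local Open Scope ereal_scope.

Definition upper_half : set X := [set p | (0 <= (p.2 : R))%R].

Lemma measurable_upper_half : measurable upper_half.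
Proof.
rewrite -[X in measurable X]setTI; apply: measurable_fun_le => //.
Qed.

(** This is [intensity mu], in a form from which its structure of measure can be
    inferred. *)
Definition intensity_measure : set X -> \bar R :=
  mrestr (mu \x leb) measurable_upper_half.

HB.instance Definition _ := Measure.on intensity_measure.

Lemma intensity_slab (U : nat -> set (borel S)) n : measurable (U n) ->
  mu (U n) < +oo -> intensity_measure (slab U n) < +oo.
Proof.
move=> mUn muU; have mslab : measurable (slab U n : set X) by exact: measurableX.
rewrite /intensity_measure /mrestr; apply: (@le_lt_trans _ _ ((mu \x leb) (slab U n))).
  apply: le_measure => //; last exact: mem_set.
  by apply/mem_set; apply: measurableI => //; exact: measurable_upper_half.
rewrite product_measure1E//.
rewrite lte_mul_pinfty//; first by rewrite ge0_fin_numE.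
rewrite /= lebesgue_measure_itv/=; case: ifPn => _; last by rewrite ltry.
by rewrite -EFinB ltry.
Qed.

Let intensity_sigma_finite : sigma_finite setT intensity_measure.
Proof.
have /sigma_finiteP[F [TF ndF Foo]] := sigma_finiteT mu.
have mF n : measurable (F n) by case: (Foo n).
exists (slab F); first by rewrite bigcup_slab.
move=> n; split; first exact: measurable_slab.
by apply: intensity_slab => //; case: (Foo n).
Qed.

HB.instance Definition _ := Measure_isSigmaFinite.Build _ _ _ intensity_measure
  intensity_sigma_finite.

Lemma intensity_xsection (A : set X) : intensity_measure A =
  \int[mu]_x leb [set v | A (x, v) /\ (0 <= v)%R].
Proof.
rewrite /intensity_measure /mrestr /product_measure1; apply: eq_integral => x _ /=.
by rewrite xsectionE.
Qed.

Lemma intensity_below (G : borel S -> R) : (forall x, 0 <= G x)%R ->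
  intensity_measure (below G) = \int[mu]_x (G x)%:E.
Proof.
move=> G0; rewrite intensity_xsection; apply: eq_integral => x _.
rewrite (_ : [set _ | _] = `[0%R, G x]%classic); last first.
  apply/seteqP; split => v; rewrite /below/= in_itv/=.
    by move=> [-> ->].
  by move=> /andP[].
rewrite lebesgue_measure_itv/= lte_fin; case: ifPn => [_|]; first by rewrite -EFinB subr0.
by rewrite -leNgt => Gx0; congr (_%:E); apply/eqP; rewrite eq_le Gx0 G0.
Qed.

(** On each vertical line this is the invariance of Lebesgue measure under
    translations, up to the point [0], which has measure zero. *)
Lemma intensity_lower (G : borel S -> R) (A : set X) : (forall x, 0 <= G x)%R ->
  measurable A ->
  intensity_measure (~` below G `&` lower G @^-1` A) = intensity_measure A.
Proof.
move=> G0 mA; rewrite !intensity_xsection; apply: eq_integral => x _.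
pose B := [set v | A (x, v) /\ (0 < v)%R] : set (measurableTypeR R).
have mAx : measurable [set v : measurableTypeR R | A (x, v)].
  have := measurable_xsection x mA; by rewrite xsectionE.
have mB : measurable B.
  have -> : B = [set v | A (x, v)] `&` `]0%R, +oo[%classic.
    by apply/seteqP; split => v /=; rewrite in_itv/= andbT.
  exact: measurableI.
rewrite (_ : [set v | _] = (fun v => v - G x)%R @^-1` B); last first.
  apply/seteqP; split => v /=; rewrite /below /lower /B /= subr_gt0.
    by move=> [[/negP]]; rewrite -ltNge.
  move=> [Av Gv]; split; first by split => //; apply/negP; rewrite -ltNge.
  by rewrite (le_trans (G0 x))// ltW.
rewrite lebesgue_measure_shift//.
have -> : [set v | A (x, v) /\ (0 <= v)%R] = B `|` ([set v | A (x, v)] `&` [set 0%R]).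
  apply/seteqP; split => [v /= [Av v0]|v /= [[Av /ltW]|[Av v0]]]//.
  have [v00|vn0] := eqVneq v 0%R; first by right.
    by left; split => //; rewrite lt_neqAle eq_sym vn0.
  by rewrite v0 in Av *; split.
apply/esym; apply: (measureU0 (mu := leb)) => //; first exact: measurableI.
apply/eqP; rewrite eq_le measure_ge0 andbT -(lebesgue_measure_set1 0%R).
by apply: le_measure => //; apply/mem_set => //; exact: measurableI.
Qed.

Section strip_law.
Variable L : probability N R.
Hypothesis L_poisson : poisson_point_process L (intensity mu) id.

Lemma poisson_void (A : set X) (r : R) : measurable A ->
  (0 <= r)%R -> intensity_measure A = r%:E ->
  L [set c | mass c A = 0] = (expR (- r))%:E.
Proof.
move=> mA r0 nuA.
have -> : L [set c | mass c A = 0] = poisson_mass (intensity_measure A) 0.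
  exact: (poisson_process_mass (nu := intensity_measure) L_poisson).
rewrite nuA /poisson_mass.
rewrite (_ : [set n | _] = [set 0%N]); last first.
  apply/seteqP; split => n /= => [/eqP|->//].
  by rewrite eqe pnatr_eq0 => /eqP.
rewrite /poisson_prob; move: r0; rewrite le_eqVlt => /predU1P[<-|r0].
  by rewrite ltxx diracE mem_set// oppr0 expR0.
by rewrite r0 esum_set1 ?lee_fin ?poisson_pmf_ge0// /poisson_pmf r0 expr0 mul1r invr1 mul1r.
Qed.

(** The parts of a Poisson process below and above the graph of [G] are
    independent, and by [intensity_lower] the part above, once lowered, has the
    intensity of the whole process. *)
Lemma void_strip_law (G : borel S -> R) (r : R) (B : set N) :
  measurable_fun setT G -> (forall x, 0 <= G x)%R ->
  (0 <= r)%R -> \int[mu]_x (G x)%:E = r%:E -> measurable B ->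
  L ([set c | mass c (below G) = 0] `&` strip G @^-1` B) = (expR (- r))%:E * L B.
Proof.
move=> mG G0 r0 intG.
have mbG := measurable_below1 mG; have msG := measurable_strip1 mG.
have mvoid : measurable [set c : N | mass c (below G) = 0].
  rewrite -[X in measurable X]setTI.
  exact: (measurable_mass mbG measurableT (emeasurable_set1 0)).
have er0 : (0 <= expR (- r))%R by exact: expR_ge0.
rewrite setIC.
apply: (@point_measures_unique R S setT (image_measure (mrestr L mvoid) msG)
  (mscale (NngNum er0) L)) => //.
  rewrite /= /image_measure /mrestr preimage_setT setTI.
  by rewrite (le_lt_trans (probability_le1 _ _)) ?ltry.
move=> I A k [mA tA _] _; rewrite /= /image_measure /mrestr /mscale /=.
(* the cells [A i], seen above the graph, and the region below the graph *)
pose A' (o : option I) := if o is Some i then ~` below G `&` lower G @^-1` A i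
  else below G.
pose k' (o : option I) := if o is Some i then k i else 0.
have mA' o : measurable (A' o).
  case: o => [i|] //=; apply: measurableI; first exact: measurableC.
  by apply: (measurable_preimage (measurable_lower1 mG)).
have tA' : trivIset setT A'.
  move=> [i|] [j|] _ _ //= [p []].
  - by move=> [_ Ai] [_ Aj]; congr Some; apply: tA => //; exists (lower G p).
  - by move=> [].
  - by move=> ? [].
rewrite (_ : _ `&` _ = counts_are A' k'); last first.
  apply/seteqP; split => [c [ck c0] [i|]//|c ck].
    by have := ck i; rewrite mass_reduce.
  by split => [i|]; [rewrite mass_reduce; exact: (ck (Some i))|exact: (ck None)].
have Lk (J : finType) (F : J -> set X) l : (forall j, measurable (F j)) ->
    trivIset setT F -> L (counts_are F l) =
    \prod_j poisson_mass (intensity_measure (F j)) (l j).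
  exact: (poisson_process_counts (nu := intensity_measure) L_poisson).
rewrite !Lk// (bigD1 None)//=; congr (_ * _).
  rewrite -(poisson_void mbG r0); last by rewrite intensity_below.
  by apply/esym; exact: (poisson_process_mass (nu := intensity_measure) L_poisson).
rewrite (reindex_omap Some id)/=; last by case.
by apply: eq_big => [i|i _] /=; [rewrite eqxx|rewrite intensity_lower].
Qed.

End strip_law.

End intensity.

(** * The first point of a configuration *)

Section indistinguishable.
Context (R : realType) (S : ptopologicalType).
Local Notation X := (point_space R S).
Local Notation N := (point_measures R S).

(** The sigma-algebra of point measures does not see how points are indexed. *)
Lemma same_masses (c c' : N) : (forall A : set X, mass c A = mass c' A) ->
  forall B : set N, measurable B -> B c <-> B c'.
Proof.
move=> cc' B; apply: (@smallest_sub _ _ (@evaluation_sets R S)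
  [set B : set N | B c <-> B c']); last first.
  by move=> _ [A [C [_ _ ->]]] /=; rewrite cc'.
split.
- by split.
- by move=> C [h1 h2]; split => -[_ Cc]; split => // h; apply: Cc; auto.
- move=> F hF; split => -[n _ Fn]; exists n => //; exact/hF.
Qed.

Lemma mass_funext (c c' : N) :
  (forall i, pindex c i <-> pindex c' i) ->
  (forall i, pindex c i -> patom c i = patom c' i) ->
  forall A : set X, mass c A = mass c' A.
Proof.
move=> pc ac A; rewrite !mass_counting; congr counting.
apply/seteqP; split => i [ci Ai]; split; first exact/pc.
- by move: Ai; rewrite /= ac.
- exact/pc.
- by rewrite /= ac//; exact/pc.
Qed.

End indistinguishable.

Section measure_eq_off_null.
Local Open Scope ereal_scope.

Lemma measure_eq_off_null d (T : measurableType d) (R : realType)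
    (m : {measure set T -> \bar R}) (D A B : set T) :
  measurable D -> m (~` D) = 0 -> measurable A -> measurable B ->
  A `&` D = B `&` D -> m A = m B.
Proof.
move=> mD mD0 mA mB AB.
have restr C : measurable C -> m C = m (C `&` D).
  move=> mC; rewrite -[in LHS](setUIDK C D) measureU0//.
  - exact: measurableI.
  - exact: measurableD.
  apply/eqP; rewrite eq_le measure_ge0 andbT -mD0; apply: le_measure.
  - by apply/mem_set; exact: measurableD.
  - by apply/mem_set; exact: measurableC.
  - by move=> x [].
by rewrite restr// AB -restr.
Qed.

End measure_eq_off_null.

Section first_point.
Context (R : realType) (S : ptopologicalType).
Local Notation X := (point_space R S).
Local Notation N := (point_measures R S).
Variable K : nat -> set X.
Hypothesis mK : forall n, measurable (K n).
Hypothesis ndK : nondecreasing_seq K.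
Hypothesis UK : \bigcup_n K n = setT.
Implicit Types (f : borel S -> R) (c : N) (p : X) (A : set X) (T : set R).
Local Open Scope ereal_scope.

(** The time at which [p] is reached by the graph of [t * f]. *)
Definition height f p : R := (p.2 / f p.1)%R.

Definition grown f (t : R) : borel S -> R := fun x => (t * f x)%R.

(** The third clause counts [p] itself when [p] belongs to [c]: no other point of
    [c] is reached by the time [height f p]. *)
Definition is_first f c p := [/\ (0 < f p.1)%R, (0 <= (p.2 : R))%R &
  mass c (below (grown f (height f p))) = 1].

Lemma below_height f p : (0 < f p.1)%R -> below (grown f (height f p)) p.
Proof. by move=> fp; rewrite /below /grown /height/= divfK// gt_eqF. Qed.

(** Of two points, the one that is reached first is below the graph when the other
    is reached. *)
Lemma is_first_uniq f c i j : (forall x, 0 <= f x)%R ->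
  pindex c i -> pindex c j -> is_first f c (patom c i) ->
  is_first f c (patom c j) -> i = j.
Proof.
move=> f0; wlog le_ij : i j / (height f (patom c i) <= height f (patom c j))%R.
  move=> wl ci cj fi fj.
  have [ij|ji] := leP (height f (patom c i)) (height f (patom c j)).
    exact: wl.
  by apply/esym; apply: wl => //; exact: ltW.
move=> ci cj [fi _ _] [fj _ /mass_eq1[k kE]].
have /= -> : i = k.
  suff : (pindex c `&` patom c @^-1` below (grown f (height f (patom c j)))) i.
    by rewrite kE.
  split => //; apply: (@le_trans _ _ (grown f (height f (patom c i)) (patom c i).1)).
    exact: below_height.
  by apply: ler_wpM2r.
suff : (pindex c `&` patom c @^-1` below (grown f (height f (patom c j)))) j.
  by rewrite kE => ->.
by split => //; exact: below_height.
Qed.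

(** Membership of [p] in [c] is not part of this definition: in [hits] it comes
    from counting the points of [c] that satisfy it. *)
Definition hit_at f A T (B : set N) c p :=
  [/\ is_first f c p, A p, T (height f p) & B (strip (grown f (height f p)) c)].

Definition hit_pairs f A T B : set (N * X) :=
  [set cp | hit_at f A T B (regularize K cp.1) cp.2].

(** As there is at most one first point, the count that is compared to [1] is the
    indicator of the event that the first point exists and has the prescribed
    properties; its expectation is a value of the Campbell measure. *)
Definition hits f A T B : set N :=
  [set c | mass (regularize K c) (hit_at f A T B (regularize K c)) = 1].

Lemma hits_regular f A T B c : regular K c -> hits f A T B c <->
  mass c (hit_at f A T B c) = 1.
Proof. by move=> rc; rewrite /hits/= regularize_id. Qed.

Lemma mass_hit_at f A T B c : (forall x, 0 <= f x)%R ->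
  mass c (hit_at f A T B c) = 0 \/ mass c (hit_at f A T B c) = 1.
Proof.
move=> f0; apply: mass_eq01 => i j ci cj [fi _ _ _] [fj _ _ _].
exact: (is_first_uniq f0 ci cj fi fj).
Qed.

Section measurability.
Context d (E : measurableType d) (f : E -> borel S -> R).
Hypothesis f_ge0 : forall y x, (0 <= f y x)%R.
Hypothesis mf : measurable_fun setT (fun q : E * borel S => f q.1 q.2).
Variables (A : set X) (T : set (measurableTypeR R)) (B : set N).
Hypotheses (mA : measurable A) (mT : measurable T) (mB : measurable B).

Let Q := ((E * N) * X)%type.

Let mf1 : measurable_fun setT (fun q : Q => f q.1.1 q.2.1).
Proof.
apply: (measurableT_comp mf (g := fun q : Q => (q.1.1, q.2.1))).
by apply: measurable_fun_pair; exact: measurableT_comp.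
Qed.

Lemma measurable_height : measurable_fun setT (fun q : Q => height (f q.1.1) q.2).
Proof.
apply: measurable_funM; first exact: measurableT_comp.
(* the inverse is a real power on nonnegative numbers *)
rewrite (_ : (fun q : Q => _) = (fun q : Q => (f q.1.1 q.2.1) `^ (-1))%R).
  exact: (measurableT_comp (measurable_powR _)).
by apply/funext => q; rewrite powR_inv1.
Qed.

Let G (q : Q) := grown (f q.1.1) (height (f q.1.1) q.2).

Let mG : measurable_fun setT (fun q : Q * borel S => G q.1 q.2).
Proof.
apply: measurable_funM; first exact: (measurableT_comp measurable_height).
apply: (measurableT_comp mf (g := fun q : Q * borel S => (q.1.1.1, q.2))).
apply: measurable_fun_pair => //; apply: measurableT_comp => //.
exact: measurableT_comp.
Qed.

Let mc : measurable_fun setT (fun q : Q => regularize K q.1.2).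
Proof.
apply: measurableT_comp; first exact: measurable_regularize.
exact: measurableT_comp.
Qed.

Let rc (q : Q) : regular K (regularize K q.1.2).
Proof. exact: regular_regularize. Qed.

Lemma measurable_hit_pairs :
  measurable [set q : Q | hit_pairs (f q.1.1) A T B (q.1.2, q.2)].
Proof.
have m1 : measurable [set q : Q | (0 < f q.1.1 q.2.1)%R].
  rewrite -[X in measurable X]setTI.
  have m0 : measurable_fun setT (fun _ : Q => 0%R : R) by exact: measurable_cst.
  have := measurable_fun_ltr m0 mf1.
  by move=> /(_ measurableT [set true]); apply.
have m2 : measurable [set q : Q | (0 <= q.2.2)%R].
  rewrite -[X in measurable X]setTI; apply: measurable_fun_le => //.
  exact: measurableT_comp.
have m3 : measurable [set q : Q | mass (regularize K q.1.2) (below (G q)) = 1].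
  rewrite -[X in measurable X]setTI.
  exact: (measurable_mass_below mG mK ndK UK mc rc measurableT (emeasurable_set1 1)).
have m4 : measurable [set q : Q | A q.2].
  exact: (measurable_preimage (measurable_snd : measurable_fun setT (@snd (E * N) X))).
have m5 : measurable [set q : Q | T (height (f q.1.1) q.2)].
  exact: (measurable_preimage measurable_height).
have m6 : measurable [set q : Q | B (strip (G q) (regularize K q.1.2))].
  exact: (measurable_preimage (measurable_strip mG mK ndK UK mc rc)).
have := measurableI _ _ (measurableI _ _ m1 m2) (measurableI _ _
  (measurableI _ _ m3 m4) (measurableI _ _ m5 m6)).
congr measurable; apply/seteqP; split => q /=.
  by move=> [[? ?] [[? ?] [? ?]]].
by move=> [[? ? ?] ? ? ?].
Qed.

Lemma measurable_hits :
  measurable [set q : E * N | hits (f q.1) A T B q.2].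
Proof.
have := measurable_regularize_xsection mK ndK UK
  (measurable_snd : measurable_fun setT (@snd E N)) measurable_hit_pairs.
move=> /(_ measurableT _ (emeasurable_set1 1)); rewrite setTI.
congr measurable; apply/seteqP; split => q; rewrite /hits/= xsectionE/=; exact.
Qed.

End measurability.

Section measurability1.
Variable f : borel S -> R.
Hypothesis f_ge0 : forall x, (0 <= f x)%R.
Hypothesis mf : measurable_fun setT f.
Variables (A : set X) (T : set (measurableTypeR R)) (B : set N).
Hypotheses (mA : measurable A) (mT : measurable T) (mB : measurable B).

Let mf' : measurable_fun setT
  (fun q : measurableTypeR R * borel S => (fun=> f) q.1 q.2).
Proof. exact: (measurableT_comp mf). Qed.

Lemma measurable_hit_pairs1 : measurable (hit_pairs f A T B).
Proof.
have mr : measurable_fun setT (fun cp : N * X => ((0%R : measurableTypeR R, cp.1), cp.2)).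
  by apply: measurable_fun_pair => //; exact: measurable_fun_pair.
have := measurable_preimage mr
  (measurable_hit_pairs (fun=> f_ge0) mf' mA mT mB).
by congr measurable; apply/seteqP; split => -[c p].
Qed.

Lemma measurable_hits1 : measurable (hits f A T B).
Proof.
have mr : measurable_fun setT (fun c : N => (0%R : measurableTypeR R, c)).
  exact: measurable_fun_pair.
exact: (measurable_preimage mr (measurable_hits (fun=> f_ge0) mf' mA mT mB)).
Qed.

End measurability1.

End first_point.

(** * The law of the first point *)

Section one_step.
Context (R : realType) (S : ptopologicalType).
Local Notation X := (point_space R S).
Local Notation N := (point_measures R S).
Variable mu : {sigma_finite_measure set (borel S) -> \bar R}.
Variable K : nat -> set X.
Hypothesis mK : forall n, measurable (K n).
Hypothesis ndK : nondecreasing_seq K.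
Hypothesis UK : \bigcup_n K n = setT.
Local Notation leb := (@lebesgue_measure R).
Local Notation nu := (intensity_measure mu).
Hypothesis nuK : forall n, (nu (K n) < +oo)%E.
Variable L : probability N R.
Hypothesis L_poisson : poisson_point_process L (intensity mu) id.
Variable f : borel S -> R.
Hypothesis f_ge0 : forall x, 0 <= f x.
Hypothesis mf : measurable_fun setT f.
Hypothesis f_density : (\int[mu]_x (f x)%:E = 1)%E.
Local Open Scope ereal_scope.

Let L_regular : L (~` regular K) = 0.
Proof. exact: (poisson_regular (nu := nu)). Qed.

Section law.
Variables (A : set (borel S)) (T : set (measurableTypeR R)) (B : set N).
Hypotheses (mA : measurable A) (mT : measurable T) (mB : measurable B).

Let AR : set X := A `*` setT.
Let mAR : measurable AR. Proof. exact: measurableX. Qed.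

Let pairs := hit_pairs K f AR T B.

Let mpairs : measurable pairs.
Proof. exact: measurable_hit_pairs1. Qed.

Let exp_density (t : R) : \bar R := (\1_T t * exponential_pdf 1 t)%:E.

Let m_exp_density :
  measurable_fun setT (exp_density : measurableTypeR R -> \bar R).
Proof.
apply/measurable_EFinP; apply: measurable_funM; first exact: measurable_indic.
exact: measurable_exponential_pdf.
Qed.

Let exp_density_ge0 t : 0 <= exp_density t.
Proof. by rewrite lee_fin mulr_ge0// exponential_pdf_ge0. Qed.

(* the probability that a point added at [p] is the first one, when [p] satisfies
   the constraints on its position and on its time *)
Let hit_density (p : X) : \bar R :=
  if (0 < f p.1)%R then (\1_A p.1)%:E * exp_density (height f p) else 0.

Let hit_density_ge0 p : 0 <= hit_density p.
Proof. by rewrite /hit_density; case: ifPn => // _; rewrite mule_ge0. Qed.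

Let m_height : measurable_fun setT (height f : X -> R).
Proof.
have mf' : measurable_fun setT
    (fun q : measurableTypeR R * borel S => (fun=> f) q.1 q.2).
  exact: (measurableT_comp mf).
have mr : measurable_fun setT
    (fun p : X => ((0%R : measurableTypeR R, point : N), p)).
  exact: measurable_fun_pair.
exact: (measurableT_comp (measurable_height (fun=> f_ge0) mf') mr).
Qed.

Let m_hit_density : measurable_fun setT hit_density.
Proof.
apply: measurable_fun_if => //.
- apply: measurable_fun_ltr => //; exact: measurableT_comp.
- apply: measurable_funTS; apply: emeasurable_funM.
    by apply/measurable_EFinP; apply: (measurableT_comp (measurable_indic mA)).
  exact: (measurableT_comp m_exp_density m_height).
Qed.

Let preimage_add p : set N := [set c | pairs (add_point c p, p)].

Let m_preimage_add p : measurable (preimage_add p).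
Proof.
have mp : measurable_fun setT (fun c : N => (c, p)).
  exact: measurable_fun_pair.
have madd : measurable_fun setT (fun c : N => (add_point c p, p)).
  apply: measurable_fun_pair => //.
  exact: (measurableT_comp (@measurable_add_point R S) mp).
exact: (measurable_preimage madd mpairs).
Qed.

(* When [p] is added, [p] is the first point if and only if there was no point
   below the graph that reaches [p]: [void_strip_law] applies. *)
Let preimage_add_law p : L (preimage_add p) = hit_density p * L B.
Proof.
rewrite /hit_density; case: ifPn => [fp|fp]; last first.
  rewrite mul0e (_ : preimage_add p = set0) ?measure0//.
  by apply/seteqP; split => // c [[]]; rewrite (negbTE fp).
have [p0|p0] := leP 0%R (p.2 : R); last first.
  rewrite (_ : preimage_add p = set0) ?measure0.
    rewrite /exp_density lt0_exponential_pdf; first by rewrite mulr0 mule0 mul0e.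
    by rewrite /height pmulr_llt0// invr_gt0.
  by apply/seteqP; split => // c [[_]]; rewrite leNgt p0.
have [Ap|Ap] := pselect (A p.1); last first.
  rewrite indicE memNset// mul0e mul0e.
  rewrite (_ : preimage_add p = set0) ?measure0//.
  by apply/seteqP; split => // c [_ []].
have [Tp|Tp] := pselect (T (height f p)); last first.
  rewrite /exp_density [\1_T _]indicE memNset//= mul0r mule0 mul0e.
  rewrite (_ : preimage_add p = set0) ?measure0//.
  by apply/seteqP; split => // c [_ _].
have h0 : (0 <= height f p)%R by rewrite divr_ge0// ltW.
pose G := grown f (height f p).
have G0 x : (0 <= G x)%R by rewrite mulr_ge0.
have mG : measurable_fun setT G by exact: measurable_funM.
have bp : below G p by exact: below_height.
rewrite indicE (mem_set Ap) mul1e /exp_density indicE mem_set//= mul1r.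
rewrite exponential_pdfE// mul1r mulN1r.
have iG : \int[mu]_x (G x)%:E = (height f p)%:E.
  under eq_integral do rewrite EFinM.
  rewrite ge0_integralZl//; last 2 first.
  - by apply/measurable_EFinP.
  - by move=> x _; rewrite lee_fin.
  by rewrite f_density mule1.
rewrite -(void_strip_law L_poisson mG G0 h0 iG mB).
have mbG := measurable_below1 mG; have msG := measurable_strip1 mG.
apply: (@measure_eq_off_null _ _ _ L (regular K)) => //.
- exact: measurable_regular.
- apply: measurableI; last exact: (measurable_preimage msG).
  rewrite -[X in measurable X]setTI.
  exact: (measurable_mass mbG measurableT (emeasurable_set1 0)).
have reg_add c : regular K c -> regularize K (add_point c p) = add_point c p.
  move=> rc; apply: regularize_id => n; rewrite mass_add_point.
  by rewrite lte_add_pinfty ?ltry//; exact: rc.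
have stripE c : B (strip G (add_point c p)) <-> B (strip G c).
  apply: same_masses mB => C; rewrite !mass_reduce mass_add_point.
  by rewrite indicE memNset ?adde0// => -[].
have belowE c : mass (add_point c p) (below G) = mass c (below G) + 1.
  by rewrite mass_add_point indicE mem_set.
apply/seteqP; split => c [+ rc]; rewrite /preimage_add /pairs /hit_pairs /=;
  rewrite reg_add//.
- move=> [[_ _ m1] _ _ Bs]; split => //; split; last exact/stripE.
  have /(congr1 (fun z => z - 1)) : mass c (below G) + 1 = 1.
    by rewrite -belowE; exact: m1.
  by rewrite addeK// subee.
- move=> [m0 Bs]; split => //; split => //; last exact/stripE.
  by split => //; rewrite [LHS](belowE c) m0 add0e.
Qed.

Let integral_hit_density : \int[nu]_p hit_density p =
  (\int[mu]_(x in A) (f x)%:E) * exponential_prob 1 T.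
Proof.
have theta : \int[leb]_t exp_density t = exponential_prob 1 T.
  rewrite /exponential_prob [RHS]integral_mkcond; apply: eq_integral => t _.
  rewrite /exp_density patchE indicE; case: ifPn => _; first by rewrite mul1r.
  by rewrite mul0r.
have theta0 : 0 <= exponential_prob 1 T by rewrite -theta integral_ge0.
transitivity (\int[mu \x leb]_p hit_density p).
  transitivity (\int[nu]_(p in @upper_half R S) hit_density p).
    rewrite [RHS]integral_mkcond; apply: eq_integral => p _; rewrite patchE.
    case: ifPn => // /negP pneg; rewrite /hit_density; case: ifPn => // fp.
    rewrite /exp_density lt0_exponential_pdf ?mulr0 ?mule0//.
    rewrite /height pmulr_llt0 ?invr_gt0// ltNge; apply/negP => p0.
    by apply: pneg; exact/mem_set.
  transitivity (\int[mu \x leb]_(p in @upper_half R S) hit_density p).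
    apply: eq_measure_integral => C mC CU; rewrite /= /intensity_measure /mrestr.
    by rewrite setIidl.
  rewrite [LHS]integral_mkcond; apply: eq_integral => p _; rewrite patchE.
  case: ifPn => // /negP pneg; rewrite /hit_density; case: ifPn => // fp.
  rewrite /exp_density lt0_exponential_pdf ?mulr0 ?mule0//.
  rewrite /height pmulr_llt0 ?invr_gt0// ltNge; apply/negP => p0.
  by apply: pneg; exact/mem_set.
rewrite fubini_tonelli1// /fubini_F.
transitivity (\int[mu]_x ((((fun x => (f x)%:E) \_ A) x) * exponential_prob 1 T)).
  apply: eq_integral => x _; rewrite /hit_density /= patchE.
  have [fx|fx] := ltP 0%R (f x); last first.
    have -> : f x = 0%R by apply/eqP; rewrite eq_le fx f_ge0.
    by rewrite integral0 if_same mul0e.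
  rewrite /height/= indicE; case: ifPn => _; last first.
    by under eq_integral do rewrite mul0e; rewrite integral0 mul0e.
  under eq_integral do rewrite mul1e.
  by rewrite ge0_integral_scale// theta.
rewrite ge0_integralZr//.
- by rewrite -integral_mkcond.
- apply/(measurable_restrict _ mA) => //; apply: measurable_funTS.
  exact/measurable_EFinP.
- by move=> x _; rewrite patchE; case: ifPn => // _; rewrite lee_fin.
Qed.

(** The probability of [hits] is the Campbell measure of [pairs].  Mecke's formula
    turns it into the integral over [p] of the probability that [p], once added,
    is the first point; this is [preimage_add_law], and it remains to integrate
    over the vertical coordinate, where [v = f x * t]. *)
Theorem hits_law : L (hits K f AR T B) =
  (\int[mu]_(x in A) (f x)%:E) * exponential_prob 1 T * L B.
Proof.
have mhits : measurable (hits K f AR T B) by exact: measurable_hits1.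
transitivity (campbell K L pairs).
  rewrite /campbell -[LHS]mul1e -(integral_cst L mhits) [LHS]integral_mkcond.
  apply: eq_integral => c _; rewrite patchE xsectionE.
  have := mass_hit_at AR T B (regularize K c) f_ge0.
  rewrite /pairs /hit_pairs /=; case: ifPn => [/set_mem -> //|/negP nh].
  by move=> [->//|h1]; exfalso; apply: nh; exact/mem_set.
rewrite (mecke_formula (nu := nu))//.
transitivity ((L \x^ nu) [set cp : N * X | pairs (add_point cp.1 cp.2, cp.2)]).
  apply: product_measure_unique.
    by move=> C D mC mD; exact: product_measure2E.
  exact: (measurable_preimage (measurable_fun_pair (@measurable_add_point R S)
    measurable_snd) mpairs).
rewrite /product_measure2.
transitivity (\int[nu]_p (hit_density p * L B)).
  apply: eq_integral => p _; rewrite /= ysectionE; exact: preimage_add_law.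
by rewrite ge0_integralZr// integral_hit_density.
Qed.

End law.

End one_step.

(** * One step of the exploration, for a given configuration *)

Section deterministic_step.
Context (R : realType) (S : ptopologicalType).
Local Notation X := (point_space R S).
Local Notation N := (point_measures R S).
Local Open Scope ereal_scope.

Lemma hit_at_first (f : borel S -> R) (c : N) : (forall x, 0 <= f x)%R ->
  mass c (hit_at f setT setT setT c) = 1 ->
  exists i, [/\ pindex c i, is_first f c (patom c i),
    pindex c `&` patom c @^-1` below (grown f (height f (patom c i))) = [set i] &
    forall A T B, mass c (hit_at f A T B c) = 1 <->
      [/\ A (patom c i), T (height f (patom c i)) &
          B (strip (grown f (height f (patom c i))) c)]].
Proof.
move=> f0 /mass_eq1[i iE].
have [ci [fi _ _ _]] : (pindex c `&` patom c @^-1` hit_at f setT setT setT c) i.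
  by rewrite iE.
exists i; split => //.
  have [_ _ /mass_eq1[j jE]] := fi; rewrite jE; congr [set _].
  suff : [set j] i by move=> /= ->.
  by rewrite -jE; split => //; apply: below_height; case: fi.
move=> A T B; split.
  move=> /mass_eq1[j jE].
  have [cj [fj Aj Tj Bj]] : (pindex c `&` patom c @^-1` hit_at f A T B c) j.
    by rewrite jE.
  by rewrite (is_first_uniq f0 ci cj fi fj).
move=> [Ai Ti Bi]; apply/mass_eq1; exists i; apply/seteqP; split.
  move=> j [cj [fj _ _ _]]; exact: (is_first_uniq f0 cj ci fj fi).
by move=> _ ->; split.
Qed.

(* [i] is the index of the first point of the residual configuration *)
Section step.
Variables (g0 : borel S -> R) (g : borel S -> borel S -> R) (c : point_family R S).
Variables (xi : nat -> R) (z : nat -> borel S) (v : nat -> R) (n : nat).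
Hypothesis g0_ge0 : forall x, (0 <= g0 x)%R.
Hypothesis g_ge0 : forall x y, (0 <= g x y)%R.

Let f : borel S -> R := step_density g0 g z n.
Let G : nat -> borel S -> R := soft_local_time g0 g xi z.
Let c' : N := residual g0 g c xi z v n.

Lemma step_density_ge0 x : (0 <= step_density g0 g z n x)%R.
Proof. by rewrite /step_density; case: n. Qed.

Variable i : nat.
Hypothesis c'i : pindex c' i.
Hypothesis first_i : is_first f c' (patom c' i).
Hypothesis only_i :
  pindex c' `&` patom c' @^-1` below (grown f (height f (patom c' i))) = [set i].

Let p := patom c' i.
Let t := height f p.

Let t_ge0 : (0 <= t)%R.
Proof. by case: first_i => fp p0 _; rewrite divr_ge0// ltW. Qed.

Let p2E : p.2 = (t * f p.1)%R.
Proof. by case: first_i => fp _ _; rewrite /t /height divfK// gt_eqF. Qed.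

Let patomE : patom c i = (p.1, (p.2 + G n p.1)%R).
Proof. by rewrite /p /= subrK -surjective_pairing. Qed.

Let patom1 : (patom c i).1 = p.1. Proof. by rewrite patomE. Qed.

Let patom2 : (patom c i).2 = (p.2 + G n p.1)%R. Proof. by rewrite patomE. Qed.

Let inf_heights : ereal_inf [set s%:E | s in [set s : R | (0 <= s)%R /\
     exists2 q, (atoms c `\` explored z v n) q & (q.2 <= G n q.1 + s * f q.1)%R]]
   = t%:E.
Proof.
apply/eqP; rewrite eq_le; apply/andP; split.
  apply: ereal_inf_lbound; exists t => //; split => //.
  have [ci ei] := c'i; exists (patom c i); first by split => //; exists i.
  by rewrite patom1 patom2 addrC lerD2l -p2E.
apply: le_ereal_inf_tmp => _ [s [s0 [_ [[j cj <-] ej]] js] <-]; rewrite lee_fin leNgt.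
apply/negP => st.
have : (pindex c' `&` patom c' @^-1` below (grown f t)) j.
  split => //; rewrite /below/= lerBlDl (le_trans js)// lerD2l.
  by rewrite ler_wpM2r ?step_density_ge0// ltW.
rewrite only_i => /= ji; move: js; rewrite ji patom1 patom2 addrC lerD2l p2E.
case: first_i => fp _ _; by rewrite ler_pM2r// leNgt st.
Qed.

Let level_set : [set q | (atoms c `\` explored z v n) q /\
    (G n q.1 + t * f q.1)%R = q.2] = [set (p.1, (p.2 + G n p.1)%R)].
Proof.
apply/seteqP; split.
  move=> _ [[[j cj <-] ej] jE].
  have : (pindex c' `&` patom c' @^-1` below (grown f t)) j.
    by split => //; rewrite /below/= lerBlDl -jE.
  by rewrite only_i => ji; rewrite (ji : j = i); exact: patomE.
move=> _ ->; rewrite -patomE; have [ci ei] := c'i; split.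
  by split => //; exists i.
by rewrite patom1 patom2 p2E addrC.
Qed.

(** When the residual configuration has a first point, the two equations of a
    step have a unique solution, given by that point. *)
Lemma soft_local_time_stepP : soft_local_time_step g0 g c xi z v n <->
  [/\ xi n.+1 = t, z n.+1 = p.1 & v n.+1 = (p.2 + G n p.1)%R].
Proof.
rewrite /soft_local_time_step [ereal_inf _]inf_heights; split.
  move=> [[xiE]]; rewrite /= xiE [X in X = _]level_set.
  move=> /seteqP[/(_ _ erefl) /= [zE vE] _].
  by rewrite -zE -vE.
move=> [xiE zE vE]; rewrite xiE; split => //.
by rewrite /= xiE zE vE; exact: level_set.
Qed.

(** The point that is removed at this step is the only one that the graph has
    reached: removing it amounts to keeping what is above the graph. *)
Lemma residual_step : soft_local_time_step g0 g c xi z v n ->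
  residual g0 g c xi z v n.+1 = strip (grown f t) c'.
Proof.
move=> /soft_local_time_stepP[xiE zE vE].
rewrite /residual /strip /reduce; congr PointFamily; last first.
  apply/funext => j; rewrite /lower /grown /=; congr pair.
  by rewrite opprD addrA xiE.
have zvE : (z n.+1, v n.+1) = patom c i by rewrite patomE zE vE.
apply/seteqP; split => j.
  move=> [cj ej]; split.
    split => // -[k /andP[k1 kn] kE]; apply: ej; exists k => //=.
    by rewrite k1 (leq_trans kn).
  move=> bj; have : (pindex c' `&` patom c' @^-1` below (grown f t)) j.
    split => //; split => // -[k /andP[k1 kn] kE]; apply: ej; exists k => //=.
    by rewrite k1 (leq_trans kn).
  rewrite only_i => ji; rewrite (ji : j = i) in ej; apply: ej.
  by exists n.+1 => //=; rewrite ltnSn.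
move=> [[cj ej] bj]; split => // -[k /andP[k1 kn] kE].
move: kn; rewrite leq_eqVlt => /predU1P[kE'|kn]; last first.
  by apply: ej; exists k => //=; rewrite k1.
apply: bj; rewrite kE' zvE in kE.
rewrite /= -kE.
suff : below (grown f t) p by [].
by rewrite /below /grown; change (p.2 <= t * f p.1)%R; rewrite -p2E.
Qed.

End step.

End deterministic_step.

(** * Measurability of the exploration *)

Section initial_segments.
Context (R : realType).

Lemma initial_segmentS (T E : Type) (X : nat -> T -> E) n w :
  initial_segment X n.+1 w = [tuple of rcons (initial_segment X n w) (X n.+1 w)].
Proof.
by apply: val_inj; rewrite /= enum_ordSr map_rcons -map_comp.
Qed.

Lemma measurable_rcons_tuple d (E : measurableType d) n :
  measurable_fun setT (fun q : n.-tuple E * E => [tuple of rcons q.1 q.2]).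
Proof.
apply/measurable_fun_tnthP => i.
have [lt_in|le_ni] := ltnP i n.
  rewrite (_ : _ \o _ = fun q => tnth q.1 (Ordinal lt_in)); last first.
    apply/funext => q /=; rewrite (tnth_nth q.2) (tnth_nth q.2) /= nth_rcons.
    by rewrite size_tuple lt_in.
  exact: (measurableT_comp (measurable_tnth _) measurable_fst).
rewrite (_ : _ \o _ = snd)//; apply/funext => q /=.
rewrite (tnth_nth q.2) /= nth_rcons size_tuple ltnNge le_ni /=.
by case: eqP => // ne; exfalso; apply: ne; apply/eqP; rewrite eqn_leq le_ni -ltnS ltn_ord.
Qed.

Lemma measurable_initial_segment d d' (T : measurableType d) (E : measurableType d')
    (X : nat -> T -> E) n :
  (forall k, (0 < k <= n)%N -> measurable_fun setT (X k)) ->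
  measurable_fun setT (initial_segment X n).
Proof.
move=> mX; apply/measurable_fun_tnthP => i.
rewrite (_ : _ \o _ = X i.+1); first by apply: mX; rewrite /= ltn_ord.
by apply/funext => w; rewrite /= tnth_mktuple.
Qed.

Lemma set_tuple0 (E : Type) (C : set (0.-tuple E)) : C = set0 \/ C = setT.
Proof.
have [C0|C0] := pselect (C [tuple]); [right|left]; apply/seteqP; split => // t.
  by rewrite (tuple0 t).
by rewrite (tuple0 t) => /C0.
Qed.

End initial_segments.

Section measurable_exploration.
Context (R : realType) (S : ptopologicalType).
Local Notation X := (point_space R S).
Local Notation N := (point_measures R S).
Hypothesis mdiag : measurable [set q : borel S * borel S | q.1 = q.2].
Variable K : nat -> set X.
Hypothesis mK : forall n, measurable (K n).
Hypothesis ndK : nondecreasing_seq K.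
Hypothesis UK : \bigcup_n K n = setT.
Variables (g0 : borel S -> R) (g : borel S -> borel S -> R).
Hypothesis g0_measurable : measurable_fun setT g0.
Hypothesis g_measurable :
  measurable_fun setT (fun p : borel S * borel S => g p.1 p.2).
Context d (Omega : measurableType d) (eta : Omega -> N).
Hypothesis meta : measurable_fun setT eta.
Hypothesis eta_regular : forall w, regular K (eta w).
Variables (xi : nat -> Omega -> R) (z : nat -> Omega -> borel S).
Variable v : nat -> Omega -> R.
Variable n : nat.
Hypothesis mxi : forall k, (0 < k <= n)%N -> measurable_fun setT (xi k).
Hypothesis mz : forall k, (0 < k <= n)%N -> measurable_fun setT (z k).
Hypothesis mv : forall k, (0 < k <= n)%N -> measurable_fun setT (v k).

Lemma measurable_step_density k : (k <= n)%N -> measurable_fun setT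
  (fun q : Omega * borel S => step_density g0 g (z^~ q.1) k q.2).
Proof.
case: k => [_|k kn]; first exact: measurableT_comp.
apply: (measurableT_comp g_measurable
  (g := fun q : Omega * borel S => (z k.+1 q.1, q.2))).
by apply: measurable_fun_pair => //; apply: measurableT_comp => //; exact: mz.
Qed.

Lemma measurable_soft_local_time k : (k <= n)%N -> measurable_fun setT
  (fun q : Omega * borel S => soft_local_time g0 g (xi^~ q.1) (z^~ q.1) k q.2).
Proof.
elim: k => [_|k IH kn] /=; first exact: measurable_cst.
apply: measurable_funD; first by apply: IH; exact: ltnW.
apply: measurable_funM; last by apply: measurable_step_density; exact: ltnW.
by apply: (measurableT_comp _ (@measurable_fst _ _ Omega (borel S))); exact: mxi.
Qed.

(** To tell the explored points from the others, the diagonal of [S * S] has to be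
    measurable for the product sigma-algebra. *)
Lemma measurable_explored :
  measurable [set q : Omega * X | explored (z^~ q.1) (v^~ q.1) n q.2].
Proof.
rewrite (_ : [set q | _] = \bigcup_(k in [set k | (1 <= k <= n)%N])
    ((fun q : Omega * X => (z k q.1, q.2.1)) @^-1` [set q | q.1 = q.2] `&`
     ([set q : Omega * X | (v k q.1 <= q.2.2)%R] `&`
      [set q : Omega * X | (q.2.2 <= v k q.1)%R]))); last first.
  apply/seteqP; split => -[w [x r]] [k kn] /=.
    by move=> [<- <-]; exists k => //; split => //; split => /=; rewrite lexx.
  move=> [zk [vk1 vk2]]; exists k => //=; rewrite zk; congr pair.
  by apply/eqP; rewrite eq_le vk1.
apply: bigcup_measurable => k kn.
have mvk : measurable_fun setT (fun q : Omega * X => v k q.1).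
  by apply: (measurableT_comp _ measurable_fst); exact: mv.
have m2 : measurable_fun setT (fun q : Omega * X => (q.2.2 : R)).
  exact: measurableT_comp.
apply: measurableI.
  apply: measurable_preimage mdiag; apply: measurable_fun_pair.
    by apply: (measurableT_comp _ measurable_fst); exact: mz.
  exact: measurableT_comp.
apply: measurableI; rewrite -[X in measurable X]setTI; exact: measurable_fun_le.
Qed.

Lemma residual_reduce w : residual g0 g (eta w) (xi^~ w) (z^~ w) (v^~ w) n =
  reduce (~` explored (z^~ w) (v^~ w) n)
         (soft_local_time g0 g (xi^~ w) (z^~ w) n) (eta w).
Proof. by rewrite /residual /reduce; congr PointFamily; rewrite setDE. Qed.

Lemma measurable_residual : measurable_fun setT (fun w =>
  residual g0 g (eta w) (xi^~ w) (z^~ w) (v^~ w) n : N).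
Proof.
under eq_fun do rewrite residual_reduce.
apply: (measurable_reduce (measurable_soft_local_time (leqnn n)) mK ndK UK meta) => //.
by apply: measurableC; exact: measurable_explored.
Qed.

End measurable_exploration.

Section step_density_of_tuple.
Context (R : realType) (S : ptopologicalType).
Variables (g0 : borel S -> R) (g : borel S -> borel S -> R).

(** The density of the next point, as a function of the points found so far. *)
Definition next_density n : n.-tuple (borel S) -> borel S -> R :=
  if n is m.+1 then fun t => g (tnth t ord_max) else fun=> g0.

Lemma step_density_next (T : Type) (z : nat -> T -> borel S) n w :
  step_density g0 g (z^~ w) n = next_density (initial_segment z n w).
Proof. by case: n => //= n; rewrite tnth_mktuple. Qed.

Lemma measurable_next_density n : measurable_fun setT g0 ->
  measurable_fun setT (fun p : borel S * borel S => g p.1 p.2) ->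
  measurable_fun setT
    (fun q : n.-tuple (borel S) * borel S => next_density q.1 q.2).
Proof.
move=> mg0 mg; case: n => [|n] /=; first exact: measurableT_comp.
apply: (measurableT_comp mg
  (g := fun q : n.+1.-tuple (borel S) * borel S => (tnth q.1 ord_max, q.2))).
apply: measurable_fun_pair => //.
exact: (measurableT_comp (measurable_tnth _) measurable_fst).
Qed.

Context (mu : {measure set (borel S) -> \bar R}).
Context d (Omega : measurableType d) (P : probability Omega R).
Variable Z : nat -> Omega -> borel S.
Hypothesis Z_markov : markov_chain P mu g0 g Z.
Local Open Scope ereal_scope.

(** For [n = 0] the initial segment is the empty tuple, and this is the law of
    [Z 1]. *)
Lemma markov_chain_next n (C : set (n.-tuple (borel S))) (A : set (borel S)) :
  measurable C -> measurable A ->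
  P (initial_segment Z n @^-1` C `&` Z n.+1 @^-1` A) =
  \int[P]_(w in initial_segment Z n @^-1` C)
     \int[mu]_(x in A) (next_density (initial_segment Z n w) x)%:E.
Proof.
move=> mC mA; have [_ Z1 Zn] := Z_markov; case: n C mC => [C mC|n C mC]; last first.
  by rewrite Zn//; apply: eq_integral => w _; rewrite -step_density_next.
have [->|->] := set_tuple0 C.
  by rewrite preimage_set0 set0I measure0 integral_set0.
rewrite preimage_setT setTI Z1//= (integral_cst P measurableT).
by rewrite -[LHS]mule1; congr (_ * _); apply/esym; exact: probability_setT.
Qed.

End step_density_of_tuple.

(** * The law of the exploration *)

Section exploration_law.
Context (R : realType) (S : ptopologicalType).
Local Notation X := (point_space R S).
Local Notation N := (point_measures R S).
Hypothesis mdiag : measurable [set q : borel S * borel S | q.1 = q.2].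
Variable mu : {sigma_finite_measure set (borel S) -> \bar R}.
Variable K : nat -> set X.
Hypothesis mK : forall n, measurable (K n).
Hypothesis ndK : nondecreasing_seq K.
Hypothesis UK : \bigcup_n K n = setT.
Hypothesis nuK : forall n, (intensity_measure mu (K n) < +oo)%E.
Variables (g0 : borel S -> R) (g : borel S -> borel S -> R).
Hypotheses (g0_ge0 : forall x, 0 <= g0 x) (g_ge0 : forall x y, 0 <= g x y).
Hypothesis g0_measurable : measurable_fun setT g0.
Hypothesis g_measurable :
  measurable_fun setT (fun p : borel S * borel S => g p.1 p.2).
Hypothesis g0_density : (\int[mu]_x (g0 x)%:E = 1)%E.
Hypothesis g_density : forall x, (\int[mu]_y (g x y)%:E = 1)%E.
Context (d' : measure_display) (Omega' : measurableType d').
Variables (P : probability Omega' R) (Z : nat -> Omega' -> borel S).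
Hypothesis Z_markov : markov_chain P mu g0 g Z.
Context (d : measure_display) (Omega : measurableType d).
Variables (Q : probability Omega R) (eta : Omega -> N).
Hypothesis eta_regular : forall w, regular K (eta w).
Hypothesis eta_poisson : poisson_point_process Q (intensity mu) eta.
Local Open Scope ereal_scope.

Let meta : measurable_fun setT eta. Proof. by case: eta_poisson. Qed.

Definition eta_law := image_measure Q meta.
HB.instance Definition _ := Probability.on eta_law.
Local Notation L := eta_law.

Lemma eta_law_poisson : poisson_point_process L (intensity mu) id.
Proof. by case: eta_poisson => _ h1 h2 h3; split. Qed.

Let next_density_ge0 n (t : n.-tuple (borel S)) x : (0 <= next_density g0 g t x)%R.
Proof. by case: n t => [|n] t /=; [exact: g0_ge0|exact: g_ge0]. Qed.

Let next_density1 n (t : n.-tuple (borel S)) :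
  \int[mu]_x (next_density g0 g t x)%:E = 1.
Proof. by case: n t => [|n] t /=; [exact: g0_density|exact: g_density]. Qed.

Let m_next_density n := @measurable_next_density R S g0 g n
  g0_measurable g_measurable.

Let m_next_density1 n (t : n.-tuple (borel S)) :
  measurable_fun setT (next_density g0 g t).
Proof.
have mt : measurable_fun setT (fun x : borel S => (t, x)).
  exact: measurable_fun_pair.
exact: (measurableT_comp (@m_next_density n) mt).
Qed.

Section exploration.
Variables (xi : nat -> Omega -> R) (z : nat -> Omega -> borel S).
Variable v : nat -> Omega -> R.

Local Notation zs := (initial_segment z).
Local Notation xis := (initial_segment xi).
Local Notation Zs := (initial_segment Z).
Let res n : Omega -> N := fun w =>
  residual g0 g (eta w) (xi^~ w) (z^~ w) (v^~ w) n.

(** The event on which step [n + 1] of the construction is possible and is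
    determined by the residual configuration. *)
Definition explorable n : set Omega := [set w | regular K (res n w) /\
  hits K (next_density g0 g (zs n w)) setT setT setT (res n w)].

Lemma explorableP n w : explorable n w -> exists p : X,
  let f := next_density g0 g (zs n w) in
  [/\ soft_local_time_step g0 g (eta w) (xi^~ w) (z^~ w) (v^~ w) n <->
      [/\ xi n.+1 w = height f p, z n.+1 w = p.1 &
          v n.+1 w = p.2 + soft_local_time g0 g (xi^~ w) (z^~ w) n p.1]%R,
      forall A T B, hits K f A T B (res n w) <->
        [/\ A p, T (height f p) & B (strip (grown f (height f p)) (res n w))] &
      soft_local_time_step g0 g (eta w) (xi^~ w) (z^~ w) (v^~ w) n ->
        res n.+1 w = strip (grown f (height f p)) (res n w)].
Proof.
move=> [rw]; rewrite hits_regular// => hw.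
have [i [ci fi oi hi]] := hit_at_first (next_density_ge0 _) hw.
exists (patom (res n w) i) => /=.
move: fi oi hi hw; rewrite -(step_density_next g0 g z n w) => fi oi hi hw.
split.
- exact: (soft_local_time_stepP g0_ge0 g_ge0 ci fi oi).
- by move=> A T B; rewrite hits_regular.
- exact: (residual_step g0_ge0 g_ge0 ci fi oi).
Qed.

Lemma explorable_hits n w : explorable n w ->
  soft_local_time_step g0 g (eta w) (xi^~ w) (z^~ w) (v^~ w) n ->
  forall A T B, hits K (next_density g0 g (zs n w)) (A `*` setT) T B (res n w) <->
    [/\ A (z n.+1 w), T (xi n.+1 w) & B (res n.+1 w)].
Proof.
move=> /explorableP[p [stepE hitsE resE]] st A T B.
have [xiE zE _] := stepE.1 st; rewrite hitsE (resE st) xiE zE.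
by split => [[[Ap _] Tp Bp]|[Ap Tp Bp]]; split.
Qed.

(** The induction hypothesis, which contains all the independence claims. *)
Definition exploration_law n := forall C D B,
  measurable C -> measurable D -> measurable B ->
  Q (zs n @^-1` C `&` xis n @^-1` D `&` res n @^-1` B) =
  P (Zs n @^-1` C) * Q (xis n @^-1` D) * L B.

Let mZs n : measurable_fun setT (Zs n).
Proof.
by apply: measurable_initial_segment => k /andP[k0 _]; case: Z_markov => + _ _; apply.
Qed.

Section step.
Variable n : nat.
Hypothesis mxi : forall k, (0 < k <= n)%N -> measurable_fun setT (xi k).
Hypothesis mz : forall k, (0 < k <= n)%N -> measurable_fun setT (z k).
Hypothesis mv : forall k, (0 < k <= n)%N -> measurable_fun setT (v k).

Let mres : measurable_fun setT (res n).
Proof. exact: (measurable_residual mdiag mK ndK UK). Qed.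

Let mzs : measurable_fun setT (zs n).
Proof. exact: measurable_initial_segment. Qed.

Let mxis : measurable_fun setT (xis n).
Proof. exact: measurable_initial_segment. Qed.

Let PZ := image_measure P (@mZs n).

Lemma measurable_probe C A (T : set (measurableTypeR R)) B :
  measurable C -> measurable A -> measurable T -> measurable B ->
  measurable [set q : n.-tuple (borel S) * N |
    C q.1 /\ hits K (next_density g0 g q.1) (A `*` setT) T B q.2].
Proof.
move=> mC mA mT mB; have mAR : measurable (A `*` [set: measurableTypeR R]).
  exact: measurableX.
have m1 : measurable [set q : n.-tuple (borel S) * N | C q.1].
  exact: (measurable_preimage (@measurable_fst _ _ (n.-tuple (borel S)) N)).
exact: (measurableI _ _ m1 (measurable_hits mK ndK UK (@next_density_ge0 n)
  (@m_next_density n) mAR mT mB)).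
Qed.

Lemma measurable_explorable : measurable (explorable n).
Proof.
apply: measurableI.
  by apply: (measurable_preimage mres); exact: measurable_regular.
exact: (measurable_preimage (measurable_fun_pair mzs mres)
  (measurable_hits mK ndK UK (@next_density_ge0 n)
  (@m_next_density n) measurableT measurableT measurableT)).
Qed.

Hypothesis law_n : exploration_law n.

(** The residual process is independent of the points found so far, also
    conditionally on the times. *)
Lemma joint_law V D : measurable V -> measurable D ->
  Q ((fun w => (zs n w, res n w)) @^-1` V `&` xis n @^-1` D) =
  Q (xis n @^-1` D) * (PZ \x L) V.
Proof.
move=> mV mD; have mxD := measurable_preimage mxis mD.
have fQ : Q (xis n @^-1` D) \is a fin_num by rewrite fin_num_measure.
rewrite -(fineK fQ).
have q0 : (0 <= fine (Q (xis n @^-1` D)))%R by rewrite fine_ge0.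
apply: (@finite_measure_unique_rectangles R _ _ _ N
  (image_measure (mrestr Q mxD) (measurable_fun_pair mzs mres))
  (mscale (NngNum q0) (PZ \x L))) => //.
  rewrite /= /image_measure /mrestr preimage_setT setTI.
  by rewrite -ge0_fin_numE.
move=> C B mC mB; rewrite /= /image_measure /mrestr /mscale /=.
rewrite product_measure1E// fineK// muleA [X in X * _]muleC -law_n//.
congr (Q _); apply/seteqP; split => w /=.
  by move=> [[? ?] ?].
by move=> [[? ?] ?].
Qed.

(** Given the points found so far, [hits_law] applies with the density of the next
    point; the integral of the transition densities is the Markov property. *)
Lemma probe_law C A T B : measurable C -> measurable A -> measurable T ->
  measurable B ->
  (PZ \x L) [set q | C q.1 /\ hits K (next_density g0 g q.1) (A `*` setT) T B q.2] =
  P (Zs n @^-1` C `&` Z n.+1 @^-1` A) * exponential_prob 1 T * L B.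
Proof.
move=> mC mA mT mB; rewrite (markov_chain_next Z_markov)//.
rewrite /product_measure1.
transitivity (\int[PZ]_t (((fun t => \int[mu]_(x in A) (next_density g0 g t x)%:E)
    \_ C) t * (exponential_prob 1 T * L B))).
  apply: eq_integral => t _; rewrite /= xsectionE patchE; case: ifPn => Ct.
    rewrite muleA -(hits_law mK ndK UK nuK eta_law_poisson
      (next_density_ge0 t) (m_next_density1 t) (next_density1 t) mA mT mB).
    by congr (L _); apply/seteqP; split => c /=; [case|split => //; exact: set_mem].
  rewrite mul0e (_ : _ @^-1` _ = set0) ?measure0//.
  by apply/seteqP; split => // c /= [Ct' _]; move/negP : Ct; apply; exact/mem_set.
have transition_ge0 t : 0 <= \int[mu]_(x in A) (next_density g0 g t x)%:E.
  by apply: integral_ge0 => x _; rewrite lee_fin.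
have mtransition : measurable_fun setT
    (fun t : n.-tuple (borel S) => \int[mu]_(x in A) (next_density g0 g t x)%:E).
  pose h (q : n.-tuple (borel S) * borel S) :=
    (\1_A q.2)%:E * (next_density g0 g q.1 q.2)%:E.
  have mh : measurable_fun setT h.
    apply: emeasurable_funM; last by apply/measurable_EFinP; exact: m_next_density.
    apply/measurable_EFinP.
    exact: (measurableT_comp (measurable_indic mA) measurable_snd).
  have h0 q : 0 <= h q by rewrite mule_ge0 ?lee_fin.
  have := measurable_fun_fubini_tonelli_F (m2 := mu) h mh h0.
  congr measurable_fun; apply/funext => t; rewrite [RHS]integral_mkcond.
  apply: eq_integral => x _; rewrite /h patchE /= indicE.
  by case: ifPn => _; rewrite ?mul1e// mul0e.
rewrite ge0_integralZr//; last 3 first.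
- by apply/(measurable_restrict _ mC) => //; exact: measurable_funTS.
- by move=> t _; rewrite patchE; case: ifPn.
- rewrite mule_ge0// integral_ge0// => x _.
  by rewrite lee_fin exponential_pdf_ge0.
rewrite muleA -integral_mkcond.
congr (_ * _ * _); apply: ge0_integral_image => //.
exact: measurable_funTS.
Qed.

(** The law of the first point has total mass one. *)
Lemma explorable_ae : Q (~` explorable n) = 0.
Proof.
have mreg : measurable (res n @^-1` regular K).
  by apply: (measurable_preimage mres); exact: measurable_regular.
pose full := (fun w => (zs n w, res n w)) @^-1`
  [set q | setT q.1 /\ hits K (next_density g0 g q.1) (setT `*` setT) setT setT q.2].
have mfullset : measurable [set q : n.-tuple (borel S) * N | setT q.1 /\
    hits K (next_density g0 g q.1) (setT `*` setT) setT setT q.2].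
  exact: measurable_probe.
have mfull : measurable full.
  exact: (measurable_preimage (measurable_fun_pair mzs mres) mfullset).
have Qreg : Q (~` (res n @^-1` regular K)) = 0.
  have mNreg : measurable (~` regular K : set N).
    by apply: measurableC; exact: measurable_regular.
  have := law_n measurableT measurableT mNreg.
  have LNreg : L (~` regular K) = 0.
    apply: (poisson_regular (nu := intensity_measure mu)) => //.
    exact: eta_law_poisson.
  by rewrite !preimage_setT !setTI LNreg mule0.
have Qfull : Q full = 1.
  have := joint_law mfullset measurableT.
  rewrite preimage_setT setIT => ->; rewrite probe_law// !preimage_setT setTI.
  have -> : exponential_prob 1 setT = 1 :> \bar R by exact: integral_exponential_pdf.
  have -> : L setT = 1 by exact: probability_setT.
  have -> : P setT = 1 by exact: probability_setT.
  have -> : Q setT = 1 by exact: probability_setT.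
  by rewrite !mule1.
have QNfull : Q (~` full) = 0.
  by rewrite probability_setC// Qfull subee.
apply/eqP; rewrite eq_le measure_ge0 andbT.
apply: (@le_trans _ _ (Q (~` (res n @^-1` regular K) `|` ~` full))).
  apply: le_measure.
  - by apply/mem_set/measurableC; exact: measurable_explorable.
  - by apply/mem_set; apply: measurableU; exact: measurableC.
  move=> w nw; have [rw|] := pselect (regular K (res n w)); last by left.
  right => -[_ hw]; apply: nw; split => //; move: hw; rewrite setXTT; exact.
have := measureU2 Q (measurableC mreg) (measurableC mfull).
move=> h; apply: (le_trans h); rewrite -[X in _ <= X]adde0.
by apply: leeD; [move: Qreg|move: QNfull] => /eqP; rewrite eq_le => /andP[].
Qed.

End step.

Section next.
Variable n : nat.
Hypothesis mxi : forall k, (0 < k <= n.+1)%N -> measurable_fun setT (xi k).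
Hypothesis mz : forall k, (0 < k <= n.+1)%N -> measurable_fun setT (z k).
Hypothesis mv : forall k, (0 < k <= n.+1)%N -> measurable_fun setT (v k).
Hypothesis law_n : exploration_law n.
Hypothesis step_n : {ae Q, forall w,
  soft_local_time_step g0 g (eta w) (xi^~ w) (z^~ w) (v^~ w) n}.

Let mxin k : (0 < k <= n)%N -> measurable_fun setT (xi k).
Proof. by move=> /andP[k0 kn]; apply: mxi; rewrite k0 /= leqW. Qed.
Let mzn k : (0 < k <= n)%N -> measurable_fun setT (z k).
Proof. by move=> /andP[k0 kn]; apply: mz; rewrite k0 /= leqW. Qed.
Let mvn k : (0 < k <= n)%N -> measurable_fun setT (v k).
Proof. by move=> /andP[k0 kn]; apply: mv; rewrite k0 /= leqW. Qed.

Let mzs : measurable_fun setT (zs n).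
Proof. exact: measurable_initial_segment. Qed.
Let mxis : measurable_fun setT (xis n).
Proof. exact: measurable_initial_segment. Qed.
Let mz1 : measurable_fun setT (z n.+1). Proof. by apply: mz; rewrite leqnn. Qed.
Let mxi1 : measurable_fun setT (xi n.+1). Proof. by apply: mxi; rewrite leqnn. Qed.
Let mres1 : measurable_fun setT (res n.+1).
Proof. exact: (measurable_residual mdiag mK ndK UK). Qed.
Let mres0 : measurable_fun setT (res n).
Proof. exact: (measurable_residual mdiag mK ndK UK). Qed.

(** On the event [explorable n], the next point, time and residual process are
    those of the first point of the residual process. *)
Lemma next_point_law C A D T B : measurable C -> measurable A -> measurable D ->
  measurable (T : set (measurableTypeR R)) -> measurable B ->
  Q ((zs n @^-1` C `&` z n.+1 @^-1` A) `&` (xis n @^-1` D `&` xi n.+1 @^-1` T) `&`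
     res n.+1 @^-1` B) =
  P (Zs n @^-1` C `&` Z n.+1 @^-1` A) * (Q (xis n @^-1` D) * exponential_prob 1 T) *
  L B.
Proof.
move=> mC mA mD mT mB.
have [N0 [mN0 QN0 stepN0]] := step_n.
pose V := [set q : n.-tuple (borel S) * N |
  C q.1 /\ hits K (next_density g0 g q.1) (A `*` setT) T B q.2].
have mV : measurable V.
  exact: measurable_probe.
transitivity (Q ((fun w => (zs n w, res n w)) @^-1` V `&` xis n @^-1` D)); last first.
  by rewrite joint_law// probe_law// -!muleA [in RHS]muleCA.
apply: (@measure_eq_off_null _ _ _ Q (explorable n `&` ~` N0)).
- apply: measurableI; last exact: measurableC.
  exact: measurable_explorable.
- rewrite setCI setCK measureU0//; first exact: explorable_ae.
  by apply: measurableC; exact: measurable_explorable.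
- apply: measurableI; last exact: (measurable_preimage mres1).
  apply: measurableI.
    by apply: measurableI; [exact: (measurable_preimage mzs)|
      exact: (measurable_preimage mz1)].
  by apply: measurableI; [exact: (measurable_preimage mxis)|
    exact: (measurable_preimage mxi1)].
- apply: measurableI; last exact: (measurable_preimage mxis).
  exact: (measurable_preimage (measurable_fun_pair mzs mres0)).
apply/seteqP; split => w [+ [ew Nw]];
  have st : soft_local_time_step g0 g (eta w) (xi^~ w) (z^~ w) (v^~ w) n
    by apply: contrapT => nst; apply: Nw; exact: stepN0.
- move=> [[[Cw Aw] [Dw Tw]] Bw]; split => //; split => //; split => //.
  by apply/explorable_hits.
- move=> [[Cw /(explorable_hits ew st)[Aw Tw Bw]] Dw]; split => //.
Qed.

(** [next_point_law] is the induction step for rectangles.  It is extended first to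
    all events on the points, then to all events on the times. *)
Lemma exploration_law_next : exploration_law n.+1.
Proof.
have zsS (C : set (n.+1.-tuple (borel S))) : zs n.+1 @^-1` C =
    (fun w => (zs n w, z n.+1 w)) @^-1`
      ((fun q : n.-tuple (borel S) * borel S => [tuple of rcons q.1 q.2]) @^-1` C).
  by apply/seteqP; split => w /=; rewrite initial_segmentS.
have ZsS (C : set (n.+1.-tuple (borel S))) : Zs n.+1 @^-1` C =
    (fun w => (Zs n w, Z n.+1 w)) @^-1`
      ((fun q : n.-tuple (borel S) * borel S => [tuple of rcons q.1 q.2]) @^-1` C).
  by apply/seteqP; split => w /=; rewrite initial_segmentS.
have xisS (D : set (n.+1.-tuple R)) : xis n.+1 @^-1` D =
    (fun w => (xis n w, xi n.+1 w)) @^-1`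
      ((fun q : n.-tuple R * R => [tuple of rcons q.1 q.2]) @^-1` D).
  by apply/seteqP; split => w /=; rewrite initial_segmentS.
have mrc e (E : measurableType e) (C : set (n.+1.-tuple E)) : measurable C ->
    measurable ((fun q : n.-tuple E * E => [tuple of rcons q.1 q.2]) @^-1` C).
  move=> mC; exact: (measurable_preimage (@measurable_rcons_tuple _ E n)).
have mZ1 : measurable_fun setT (Z n.+1) by case: Z_markov => + _ _; apply.
have PT : P setT = 1 by exact: probability_setT.
have LT : L setT = 1 by exact: probability_setT.
have fL (B : set N) : measurable B -> L B \is a fin_num.
  by move=> mB; rewrite fin_num_measure.
have xi_law D T : measurable D -> measurable (T : set (measurableTypeR R)) ->
    Q (xis n @^-1` D `&` xi n.+1 @^-1` T) = Q (xis n @^-1` D) * exponential_prob 1 T.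
  move=> mD mT.
  have := next_point_law measurableT measurableT mD mT measurableT.
  by rewrite !preimage_setT !setTI setIT PT LT mul1e mule1.
have law_rect C D T B : measurable C -> measurable D ->
    measurable (T : set (measurableTypeR R)) -> measurable B ->
    Q (xis n @^-1` D `&` xi n.+1 @^-1` T `&` (zs n.+1 @^-1` C `&` res n.+1 @^-1` B)) =
    Q (xis n @^-1` D `&` xi n.+1 @^-1` T) * (P (Zs n.+1 @^-1` C) * L B).
  move=> mC mD mT mB.
  have mxx : measurable (xis n @^-1` D `&` xi n.+1 @^-1` T).
    by apply: measurableI; [exact: (measurable_preimage mxis)|
      exact: (measurable_preimage mxi1)].
  have mF : measurable (xis n @^-1` D `&` xi n.+1 @^-1` T `&` res n.+1 @^-1` B).
    by apply: measurableI => //; exact: (measurable_preimage mres1).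
  rewrite muleCA setICA zsS ZsS.
  apply: (joint_law_rectangles mzs mz1 (@mZs n) mZ1 mF) => //.
  - by rewrite mule_ge0.
  - by rewrite fin_numM ?fL// fin_num_measure.
  - move=> A1 A2 mA1 mA2; rewrite setIA next_point_law// xi_law//.
    by rewrite -!muleA.
  - exact: mrc.
move=> C D B mC mD mB.
have mzC : measurable (zs n.+1 @^-1` C).
  apply: (measurable_preimage _ mC).
  exact: measurable_initial_segment.
have mF : measurable (zs n.+1 @^-1` C `&` res n.+1 @^-1` B).
  by apply: measurableI => //; exact: (measurable_preimage mres1).
rewrite muleAC muleC -setIA setICA xisS.
apply: (joint_law_rectangles mxis mxi1 mxis mxi1 mF) => //.
- by rewrite mule_ge0.
- rewrite fin_numM ?fL// fin_num_measure//.
  exact: (measurable_preimage (@mZs n.+1)).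
- by move=> D1 D2 mD1 mD2; exact: law_rect.
- exact: mrc.
Qed.

End next.

Lemma exploration_law0 : exploration_law 0.
Proof.
move=> C D B mC mD mB.
have resE w : B (res 0%N w) <-> B (eta w).
  apply: (same_masses _ mB) => A; apply: mass_funext => i.
    rewrite /res /=; split => [[]//|ci]; split => // -[k /andP[k1 k0]].
    by move: (leq_trans k1 k0).
  by move=> _ /=; rewrite subr0 -surjective_pairing.
have -> : res 0%N @^-1` B = eta @^-1` B by apply/seteqP; split => w /resE.
have [->|->] := set_tuple0 C; first by rewrite !preimage_set0 !set0I !measure0 !mul0e.
have [->|->] := set_tuple0 D.
  by rewrite !preimage_set0 setI0 set0I !measure0 mule0 mul0e.
rewrite !preimage_setT !setTI.
have -> : P setT = 1 by exact: probability_setT.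
have -> : Q setT = 1 by exact: probability_setT.
by rewrite !mul1e.
Qed.

Lemma exploration_lawP n :
  (forall k, (0 < k <= n)%N -> measurable_fun setT (xi k)) ->
  (forall k, (0 < k <= n)%N -> measurable_fun setT (z k)) ->
  (forall k, (0 < k <= n)%N -> measurable_fun setT (v k)) ->
  (forall k, (k < n)%N -> {ae Q, forall w,
    soft_local_time_step g0 g (eta w) (xi^~ w) (z^~ w) (v^~ w) k}) ->
  exploration_law n.
Proof.
elim: n => [_ _ _ _|n IH mxi mz mv st]; first exact: exploration_law0.
apply: exploration_law_next => //; last exact: st.
have le_n k : (0 < k <= n)%N -> (0 < k <= n.+1)%N.
  by move=> /andP[-> kn]; rewrite leqW.
apply: IH => k kn; [by apply: mxi; exact: le_n|by apply: mz; exact: le_n|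
  by apply: mv; exact: le_n|by apply: st; exact: leqW].
Qed.

End exploration.
End exploration_law.

(** * Existence of the construction *)

Section first_point_choice.
Context (R : realType) (S : ptopologicalType).
Local Notation X := (point_space R S).
Local Notation N := (point_measures R S).
Variable K : nat -> set X.
Hypothesis mK : forall n, measurable (K n).
Hypothesis ndK : nondecreasing_seq K.
Hypothesis UK : \bigcup_n K n = setT.
Local Open Scope ereal_scope.

Definition has_first (f : borel S -> R) (c : N) :=
  regular K c /\ hits K f setT setT setT c.

(** The choice of a default value outside [has_first f c] makes this a measurable
    function of [f] and [c]. *)
Definition first_point (f : borel S -> R) (c : N) : X :=
  xget (point, 0%R) [set p | has_first f c /\ hits K f [set p] setT setT c].

Lemma first_pointE (f : borel S -> R) (c : N) (p : X) : has_first f c ->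
  (forall A : set X, hits K f A setT setT c <-> A p) -> first_point f c = p.
Proof.
move=> fc pA; apply: xget_unique; first by split => //; apply/pA.
by move=> q [_ /pA].
Qed.

Section measurability.
Context d (T : measurableType d) (f : T -> borel S -> R) (c : T -> N).
Hypothesis f_ge0 : forall t x, (0 <= f t x)%R.
Hypothesis mf : measurable_fun setT (fun q : T * borel S => f q.1 q.2).
Hypothesis mc : measurable_fun setT c.

Lemma measurable_hits_comp (A : set X) : measurable A ->
  measurable [set t | hits K (f t) A setT setT (c t)].
Proof.
move=> mA; exact: (measurable_preimage (measurable_fun_pair (@measurable_id _ T setT) mc)
  (measurable_hits mK ndK UK f_ge0 mf mA measurableT measurableT)).
Qed.

Lemma measurable_has_first : measurable [set t | has_first (f t) (c t)].
Proof.
apply: measurableI; last exact: measurable_hits_comp.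
by apply: (measurable_preimage mc); exact: measurable_regular.
Qed.

(** Where it exists, the first point is in [A] on the event [hits K f A setT setT],
    so that its measurability reduces to that of the events [hits]. *)
Lemma measurable_first_point :
  measurable_fun setT (fun t => first_point (f t) (c t)).
Proof.
move=> _ A mA; rewrite setTI.
pose F := [set t | has_first (f t) (c t)].
have FE t : F t -> forall A : set X,
    hits K (f t) A setT setT (c t) <-> A (first_point (f t) (c t)).
  move=> Ft; have [rc hc] := Ft; move: hc; rewrite hits_regular// => hc.
  have [i [ci fi oi hi]] := hit_at_first (f_ge0 t) hc.
  have hA (A' : set X) : hits K (f t) A' setT setT (c t) <-> A' (patom (c t) i).
    by rewrite hits_regular// hi; split => [[]|].
  by move=> A'; rewrite hA (first_pointE Ft hA).
rewrite (_ : _ @^-1` A = (F `&` [set t | hits K (f t) A setT setT (c t)]) `|`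
    (~` F `&` [set t | A (point, 0%R)])).
  apply: measurableU.
    by apply: measurableI; [exact: measurable_has_first|exact: measurable_hits_comp].
  apply: measurableI; first by apply: measurableC; exact: measurable_has_first.
  have [Ap|Ap] := pselect (A (point, 0%R)).
    by rewrite (_ : [set t | _] = setT)//; apply/seteqP; split.
  by rewrite (_ : [set t | _] = set0)//; apply/seteqP; split.
have default t : ~ F t -> first_point (f t) (c t) = (point, 0%R).
  move=> Ft; rewrite /first_point; case: xgetP => // p _ [].
  by move=> /Ft.
apply/seteqP; split => t /=.
  move=> At; have [Ft|Ft] := pselect (F t).
    by left; split => //; apply/FE.
  by right; split => //; rewrite -(default t Ft).
move=> [[Ft hA]|[Ft Ap]]; first by apply/FE.
by rewrite default.
Qed.

End measurability.

End first_point_choice.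

Section congruence.
Context (R : realType) (S : ptopologicalType).
Variables (g0 : borel S -> R) (g : borel S -> borel S -> R).
Variables (xi xi' : nat -> R) (z z' : nat -> borel S) (v v' : nat -> R).

Lemma step_density_congr n : (forall k, (k <= n)%N -> z k = z' k) ->
  step_density g0 g z n = step_density g0 g z' n.
Proof. by case: n => //= n zz'; rewrite zz'. Qed.

Lemma soft_local_time_congr n : (forall k, (k <= n)%N -> xi k = xi' k) ->
  (forall k, (k <= n)%N -> z k = z' k) ->
  soft_local_time g0 g xi z n = soft_local_time g0 g xi' z' n.
Proof.
elim: n => // n IH xx zz; apply/funext => x /=.
have xxn k : (k <= n)%N -> xi k = xi' k by move=> kn; apply: xx; exact: leqW.
have zzn k : (k <= n)%N -> z k = z' k by move=> kn; apply: zz; exact: leqW.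
by rewrite xx// (IH xxn zzn) (step_density_congr zzn).
Qed.

Lemma residual_congr (c : point_family R S) n :
  (forall k, (k <= n)%N -> xi k = xi' k) ->
  (forall k, (k <= n)%N -> z k = z' k) -> (forall k, (k <= n)%N -> v k = v' k) ->
  residual g0 g c xi z v n = residual g0 g c xi' z' v' n.
Proof.
move=> xx zz vv; rewrite /residual (soft_local_time_congr xx zz).
suff -> : explored z v n = explored z' v' n by [].
by rewrite /explored; apply: eq_imagel => k /= /andP[_ kn]; rewrite zz// vv.
Qed.

End congruence.

Section construction.
Context (R : realType) (S : ptopologicalType).
Local Notation X := (point_space R S).
Local Notation N := (point_measures R S).
Variable K : nat -> set X.
Variables (g0 : borel S -> R) (g : borel S -> borel S -> R).

(** The first [n] steps of the exploration of [c], as sequences which are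
    constant from index [n + 1] on. *)
Fixpoint explore (c : N) (n : nat) : (nat -> R) * (nat -> borel S) * (nat -> R) :=
  if n is m.+1 then
    let: (xi, z, v) := explore c m in
    let f := step_density g0 g z m in
    let p := first_point K f (residual g0 g c xi z v m) in
    (fun k => if (k <= m)%N then xi k else height f p,
     fun k => if (k <= m)%N then z k else p.1,
     fun k => if (k <= m)%N then v k else p.2 + soft_local_time g0 g xi z m p.1)
  else (fun=> 0, fun=> point, fun=> 0).

Definition explore_xi c n := (explore c n).1.1 n.
Definition explore_z c n := (explore c n).1.2 n.
Definition explore_v c n := (explore c n).2 n.

Lemma explore_stable c n k : (k <= n)%N ->
  [/\ (explore c n).1.1 k = explore_xi c k, (explore c n).1.2 k = explore_z c k &
      (explore c n).2 k = explore_v c k].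
Proof.
elim: n => [|n IH]; first by rewrite leqn0 => /eqP ->.
rewrite leq_eqVlt => /predU1P[->//|]; rewrite ltnS => kn.
have [<- <- <-] := IH kn.
by rewrite /=; case: (explore c n) => [[xi z] v] /=; rewrite kn.
Qed.

Lemma exploreS c n :
  let f := step_density g0 g (explore_z c) n in
  let p := first_point K f
    (residual g0 g c (explore_xi c) (explore_z c) (explore_v c) n) in
  [/\ explore_xi c n.+1 = height f p, explore_z c n.+1 = p.1 &
      explore_v c n.+1 =
        p.2 + soft_local_time g0 g (explore_xi c) (explore_z c) n p.1].
Proof.
have xx k : (k <= n)%N -> (explore c n).1.1 k = explore_xi c k.
  by move=> kn; have [] := @explore_stable c n k kn.
have zz k : (k <= n)%N -> (explore c n).1.2 k = explore_z c k.
  by move=> kn; have [] := @explore_stable c n k kn.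
have vv k : (k <= n)%N -> (explore c n).2 k = explore_v c k.
  by move=> kn; have [] := @explore_stable c n k kn.
rewrite /= -(residual_congr g0 g c xx zz vv) -(step_density_congr g0 g zz).
rewrite -(soft_local_time_congr g0 g xx zz).
rewrite [explore_xi c n.+1]/explore_xi [explore_z c n.+1]/explore_z.
rewrite [explore_v c n.+1]/explore_v /=.
by case: (explore c n) => [[xi z] v] /=; rewrite ltnn.
Qed.

End construction.

Section existence.
Context (R : realType) (S : ptopologicalType).
Local Notation X := (point_space R S).
Local Notation N := (point_measures R S).
Hypothesis mdiag : measurable [set q : borel S * borel S | q.1 = q.2].
Variable mu : {sigma_finite_measure set (borel S) -> \bar R}.
Variable K : nat -> set X.
Hypothesis mK : forall n, measurable (K n).
Hypothesis ndK : nondecreasing_seq K.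
Hypothesis UK : \bigcup_n K n = setT.
Hypothesis nuK : forall n, (intensity_measure mu (K n) < +oo)%E.
Variables (g0 : borel S -> R) (g : borel S -> borel S -> R).
Hypotheses (g0_ge0 : forall x, 0 <= g0 x) (g_ge0 : forall x y, 0 <= g x y).
Hypothesis g0_measurable : measurable_fun setT g0.
Hypothesis g_measurable :
  measurable_fun setT (fun p : borel S * borel S => g p.1 p.2).
Hypothesis g0_density : (\int[mu]_x (g0 x)%:E = 1)%E.
Hypothesis g_density : forall x, (\int[mu]_y (g x y)%:E = 1)%E.
Context (d' : measure_display) (Omega' : measurableType d').
Variables (P : probability Omega' R) (Z : nat -> Omega' -> borel S).
Hypothesis Z_markov : markov_chain P mu g0 g Z.
Context (d : measure_display) (Omega : measurableType d).
Variables (Q : probability Omega R) (eta : Omega -> N).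
Hypothesis eta_regular : forall w, regular K (eta w).
Hypothesis eta_poisson : poisson_point_process Q (intensity mu) eta.

Let meta : measurable_fun setT eta. Proof. by case: eta_poisson. Qed.

Let xi n w := explore_xi K g0 g (eta w) n.
Let z n w := explore_z K g0 g (eta w) n.
Let v n w := explore_v K g0 g (eta w) n.

Let measurable_exploration n :
  [/\ measurable_fun setT (xi n), measurable_fun setT (z n) &
      measurable_fun setT (v n)].
Proof.
elim/ltn_ind: n => -[_|n IH].
  by split; exact: measurable_cst.
have mxi k : (0 < k <= n)%N -> measurable_fun setT (xi k).
  by move=> /andP[_ kn]; have [] := IH k kn.
have mz k : (0 < k <= n)%N -> measurable_fun setT (z k).
  by move=> /andP[_ kn]; have [] := IH k kn.
have mv k : (0 < k <= n)%N -> measurable_fun setT (v k).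
  by move=> /andP[_ kn]; have [] := IH k kn.
pose f w := step_density g0 g (z^~ w) n.
pose res w : N := residual g0 g (eta w) (xi^~ w) (z^~ w) (v^~ w) n.
pose p w := first_point K (f w) (res w).
have mf : measurable_fun setT (fun q : Omega * borel S => f q.1 q.2).
  exact: (measurable_step_density (n := n) g0_measurable g_measurable mz).
have mres : measurable_fun setT res.
  exact: (measurable_residual mdiag mK ndK UK g0_measurable g_measurable meta).
have f0 w x : 0 <= f w x by exact: step_density_ge0.
have mp : measurable_fun setT p by exact: measurable_first_point.
have mp1 : measurable_fun setT (fun w => (p w).1).
  exact: (measurableT_comp measurable_fst mp).
have mp2 : measurable_fun setT (fun w => (p w).2).
  exact: (measurableT_comp measurable_snd mp).
have mwp : measurable_fun setT (fun w => (w, (p w).1)).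
  exact: measurable_fun_pair.
split.
- rewrite (_ : xi n.+1 = fun w => height (f w) (p w)); last first.
    by apply/funext => w; have [e _ _] := exploreS K g0 g (eta w) n; exact: e.
  have mq : measurable_fun setT (fun w => ((w, point : N), p w)).
    by apply: measurable_fun_pair => //; exact: measurable_fun_pair.
  exact: (measurableT_comp (measurable_height f0 mf) mq).
- rewrite (_ : z n.+1 = fun w => (p w).1)//.
  by apply/funext => w; have [_ e _] := exploreS K g0 g (eta w) n; exact: e.
- rewrite (_ : v n.+1 = fun w => (p w).2 +
      soft_local_time g0 g (xi^~ w) (z^~ w) n (p w).1); last first.
    by apply/funext => w; have [_ _ e] := exploreS K g0 g (eta w) n; exact: e.
  apply: measurable_funD => //.
  exact: (measurableT_comp (measurable_soft_local_time g0_measurable g_measurable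
    mxi mz (leqnn n)) mwp).
Qed.

Let exploration_steps n : {ae Q, forall w,
  soft_local_time_step g0 g (eta w) (xi^~ w) (z^~ w) (v^~ w) n}.
Proof.
elim/ltn_ind: n => n IH.
have mxi k : (0 < k <= n)%N -> measurable_fun setT (xi k).
  by move=> _; have [] := measurable_exploration k.
have mz k : (0 < k <= n)%N -> measurable_fun setT (z k).
  by move=> _; have [] := measurable_exploration k.
have mv k : (0 < k <= n)%N -> measurable_fun setT (v k).
  by move=> _; have [] := measurable_exploration k.
have law_n : exploration_law g0 g P Z eta_poisson xi z v n.
  exact: exploration_lawP.
exists (~` explorable K g0 g eta xi z v n); split.
- apply: measurableC; exact: (measurable_explorable mdiag mK ndK UK g0_ge0 g_ge0
    g0_measurable g_measurable eta_regular eta_poisson mxi mz mv).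
- exact: (explorable_ae mdiag mK ndK UK nuK g0_ge0 g_ge0 g0_measurable
    g_measurable g0_density g_density Z_markov eta_regular mxi mz mv law_n).
move=> w /= nst ew; apply: nst.
have [p [stepE hitsE _]] := explorableP g0_ge0 g_ge0 ew.
apply/stepE.
have <- : first_point K (next_density g0 g (initial_segment z n w))
    (residual g0 g (eta w) (xi^~ w) (z^~ w) (v^~ w) n) = p.
  by apply: first_pointE => // A; rewrite hitsE; split => [[]|].
rewrite -(step_density_next g0 g z n w).
exact: (exploreS K g0 g (eta w) n).
Qed.

(** Each step is almost surely possible by [explorable_ae], whose hypothesis on the
    law of the exploration only involves the previous steps. *)
Lemma soft_local_time_construction_exists :
  soft_local_time_construction Q g0 g eta xi z v.
Proof.
split; first by move=> n _; exact: measurable_exploration.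
by apply/ae_foralln.
Qed.

End existence.

(** * Separable, locally compact metric spaces *)

Section separable_metric.
Context (R : realType) (S : completePMetricType R).

Lemma metric_ball_open (x : S) (r : R) : open (ball x r).
Proof.
rewrite openE => y; rewrite ballEmdist /= => xy; apply/nbhs_ballP.
exists (r - mdist x y); first by rewrite /= subr_gt0.
move=> t; rewrite !ballEmdist /= ltrBrDl => yt.
by rewrite (le_lt_trans (metric_triangle x y t)).
Qed.

Lemma dense_sequence : separable S ->
  exists s : nat -> S, forall O : set S, open O -> O !=set0 -> exists n, O (s n).
Proof.
move=> [D /countable_injP[h hinj] dD].
exists (fun n => xget point [set x | D x /\ h x = n]) => O oO O0.
have [x [Ox Dx]] := dD O O0 oO; exists (h x).
case: xgetP => [y _ [Dy hy]|/(_ x) []//].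
have -> : y = x by apply: hinj => //; exact: mem_set.
by [].
Qed.

Lemma countable_base : separable S -> exists B : nat -> set S,
  (forall n, open (B n)) /\
  forall y V, nbhs y V -> exists2 n, B n y & B n `<=` V.
Proof.
move=> /dense_sequence[s sP].
pose ij n := odflt (0%N, 0%N) (choice.unpickle n : option (nat * nat)).
exists (fun n => ball (s (ij n).1) (ij n).2.+1%:R^-1); split.
  by move=> n; exact: metric_ball_open.
move=> y V /nbhs_ballP[e /= e0 eV].
have [j je] : exists j : nat, j.+1%:R^-1 < e / 2.
  exists (Num.truncn (e / 2)^-1); rewrite invf_plt ?posrE ?divr_gt0//.
  exact: truncnS_gt.
have [|i yi] := sP _ (metric_ball_open y j.+1%:R^-1).
  by exists y; apply: ballxx; rewrite invr_gt0.
exists (choice.pickle (i, j)); rewrite /ij choice.pickleK /=; first exact: ball_sym.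
move=> t it; apply: eV; apply: (@le_ball _ _ _ (j.+1%:R^-1 + j.+1%:R^-1)).
  by rewrite [leRHS](splitr e) lerD// ltW.
exact: (ball_triangle yi it).
Qed.

Lemma borel_open (A : set S) : open A -> measurable (A : set (borel S)).
Proof. exact: sub_sigma_algebra. Qed.

(** Two points differ if and only if a set of the countable base contains one but
    not the other. *)
Lemma measurable_diagonal : separable S ->
  measurable [set q : borel S * borel S | q.1 = q.2].
Proof.
move=> /countable_base[B [oB BP]].
rewrite -[X in measurable X]setCK; apply: measurableC.
rewrite (_ : ~` _ = \bigcup_n (fst @^-1` (B n : set (borel S)) `&`
    snd @^-1` (~` B n : set (borel S)))).
  apply: bigcup_measurable => n _; apply: measurableI.
    by apply: (measurable_preimage measurable_fst); exact: borel_open.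
  by apply: (measurable_preimage measurable_snd); apply: measurableC; exact: borel_open.
apply/seteqP; split => -[x y] /=; last by move=> [n _ [/= Bx By] xy]; rewrite xy in Bx.
move=> xy; have : nbhs (x : S) (ball (x : S) (mdist (x : S) y)).
  by apply: nbhsx_ballx; rewrite mdist_gt0; apply/eqP.
move=> /BP[n Bx Bxy]; exists n => //; split => //= By.
by have := Bxy _ By; rewrite ballEmdist /= ltxx.
Qed.

(** The sets of the countable base that are contained in a compact set cover
    [S]. *)
Lemma relatively_compact_cover : separable S -> locally_compact [set: S] ->
  exists U : nat -> set (borel S), [/\ forall n, measurable (U n),
    nondecreasing_seq U, \bigcup_n U n = setT &
    forall n, exists2 C : set S, compact C & U n `<=` C].
Proof.
move=> /countable_base[B [oB BP]] lcS.
pose good n := exists2 C : set S, compact C & B n `<=` C.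
exists (fun k => \bigcup_(n in [set n | (n < k)%N /\ good n]) B n); split.
- by move=> k; apply: bigcup_measurable => n _; exact: borel_open.
- move=> m n mn; apply/subsetPset => x [k [km gk] Bx]; exists k => //.
  by split => //; exact: leq_trans mn.
- apply/seteqP; split => // x _.
  have [C xC [cC _]] := lcS x Logic.I.
  have [n Bx BC] := BP x C (filterS (fun y h => h Logic.I) xC).
  by exists n.+1 => //; exists n => //; split => //; exists C.
elim=> [|k [C cC UC]]; first by exists set0; [exact: compact0|move=> x [n []]].
have [[D cD BD]|ngk] := pselect (good k).
  exists (C `|` D); first exact: compactU.
  move=> x [n [nk gn] Bx]; move: nk; rewrite ltnS leq_eqVlt => /predU1P[nk|nk].
    by right; apply: BD; rewrite -nk.
  by left; apply: UC; exists n.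
exists C => // x [n [nk gn] Bx]; apply: UC; exists n => //; split => //.
move: nk; rewrite ltnS leq_eqVlt => /predU1P[nk|//].
by exfalso; apply: ngk; rewrite -nk.
Qed.

Lemma borel_compact (C : set S) : compact C -> measurable (C : set (borel S)).
Proof.
move=> cC; rewrite -[X in measurable X]setCK; apply: measurableC.
apply: borel_open; apply: closed_openC; apply: compact_closed cC.
exact: metric_hausdorff.
Qed.

End separable_metric.

(** * The theorem *)

Theorem proposition4p3
  (R : realType) (S : completePMetricType R)
  (S_separable : separable S) (S_locally_compact : locally_compact [set: S])
  (mu : {measure set (borel S) -> \bar R})
  (mu_radon : finite_on_compacts (mu : set S -> \bar R))
  (g0 : borel S -> R) (g : borel S -> borel S -> R)
  (g0_ge0 : forall x, 0 <= g0 x) (g_ge0 : forall x y, 0 <= g x y)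
  (g0_measurable : measurable_fun setT g0)
  (g_measurable : measurable_fun setT (fun p : borel S * borel S => g p.1 p.2))
  (g0_density : (\int[mu]_x (g0 x)%:E = 1)%E)
  (g_density : forall x, (\int[mu]_y (g x y)%:E = 1)%E)
  (d' : measure_display) (Omega' : measurableType d')
  (P : probability Omega' R) (Z : nat -> Omega' -> borel S)
  (Z_markov : markov_chain P mu g0 g Z)
  (d : measure_display) (Omega : measurableType d)
  (Q : probability Omega R) (eta : Omega -> point_measures R S)
  (eta_ge0 : forall w p, atoms (eta w) p -> 0 <= p.2)
  (eta_locally_finite : forall w, finite_on_compacts (mass (eta w)))
  (eta_poisson : poisson_point_process Q (intensity mu) eta) :
  (exists (xi : nat -> Omega -> R) (z : nat -> Omega -> borel S)
          (v : nat -> Omega -> R),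
     soft_local_time_construction Q g0 g eta xi z v) /\
  (forall (xi : nat -> Omega -> R) (z : nat -> Omega -> borel S)
          (v : nat -> Omega -> R),
     soft_local_time_construction Q g0 g eta xi z v ->
     forall n, (0 < n)%N ->
       let zs := initial_segment z n in
       let xis := initial_segment xi n in
       let eta' : Omega -> point_measures R S := fun w =>
         residual g0 g (eta w) (xi^~ w) (z^~ w) (v^~ w) n in
       [/\ equal_in_law Q zs P (initial_segment Z n),
           independent Q zs xis,
           measurable_fun setT eta',
           equal_in_law Q eta' Q eta
         & independent Q eta' (fun w => (zs w, xis w))]).
Proof.
have mdiag := measurable_diagonal S_separable.
have [U [mU ndU UU UC]] := relatively_compact_cover S_separable S_locally_compact.
have muU n : (mu (U n) < +oo)%E.
  have [C cC UCn] := UC n; apply: (le_lt_trans _ (mu_radon _ cC)).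
  by apply: le_measure => //; apply/mem_set => //; exact: borel_compact.
have sf_mu : sigma_finite setT mu by exists U => // n; split.
pose nu : {sigma_finite_measure set (borel S) -> \bar R} := as_sigma_finite sf_mu.
pose K := slab U : nat -> set (point_space R S).
have mK n : measurable (K n) by exact: measurable_slab.
have ndK : nondecreasing_seq K by exact: nondecreasing_slab.
have UK : \bigcup_n K n = setT by exact: bigcup_slab.
have nuK n : (intensity_measure nu (K n) < +oo)%E.
  exact: (@intensity_slab R S nu U n (mU n) (muU n)).
have eta_regular w : regular K (eta w).
  move=> n; have [C cC UCn] := UC n.
  have cCI : compact (C `*` `[(- n%:R)%R, n%:R]%classic : set (S * R)).
    by apply: compact_setX => //; exact: segment_compact.
  apply: (le_lt_trans _ (eta_locally_finite w _ cCI)); rewrite !massE.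
  apply: le_measure; [exact: mem_set| |by move=> [x r] [/UCn]].
  by apply/mem_set; apply: measurableX => //; exact: borel_compact.
have eta_poisson' : poisson_point_process Q (intensity nu) eta by exact: eta_poisson.
have Z_markov' : markov_chain P nu g0 g Z by exact: Z_markov.
split.
  do 3!eexists.
  exact: (soft_local_time_construction_exists mdiag mK ndK UK nuK g0_ge0 g_ge0
    g0_measurable g_measurable g0_density g_density Z_markov' eta_regular
    eta_poisson').
move=> xi z v [mxzv steps] n n0 zs xis eta'.
have mxi k : (0 < k <= n)%N -> measurable_fun setT (xi k).
  by move=> /andP[k0 _]; have [] := mxzv k k0.
have mz k : (0 < k <= n)%N -> measurable_fun setT (z k).
  by move=> /andP[k0 _]; have [] := mxzv k k0.
have mv k : (0 < k <= n)%N -> measurable_fun setT (v k).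
  by move=> /andP[k0 _]; have [] := mxzv k k0.
have meta : measurable_fun setT eta by case: eta_poisson.
have law_n : exploration_law g0 g P Z eta_poisson' xi z v n.
  apply: (exploration_lawP mdiag mK ndK UK nuK g0_ge0 g_ge0 g0_measurable
    g_measurable g0_density g_density Z_markov' eta_regular eta_poisson'
    mxi mz mv) => k _.
  by apply: filterS steps => w; exact.
have mzs : measurable_fun setT zs by exact: measurable_initial_segment.
have mxis : measurable_fun setT xis by exact: measurable_initial_segment.
have meta' : measurable_fun setT eta'.
  exact: (measurable_residual mdiag mK ndK UK g0_measurable g_measurable meta
    eta_regular mxi mz mv).
have QT : (Q setT = 1)%E by exact: probability_setT.
have PT : (P setT = 1)%E by exact: probability_setT.
have LT : (eta_law eta_poisson' setT = 1)%E by exact: probability_setT.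
have law_zs C : measurable C -> Q (zs @^-1` C) = P (initial_segment Z n @^-1` C).
  move=> mC; have := law_n C setT setT mC measurableT measurableT.
  by rewrite !preimage_setT !setIT QT LT !mule1.
have law_zs_xis C D : measurable C -> measurable D ->
    (Q (zs @^-1` C `&` xis @^-1` D) = Q (zs @^-1` C) * Q (xis @^-1` D))%E.
  move=> mC mD; have := law_n C D setT mC mD measurableT.
  by rewrite preimage_setT setIT LT mule1 law_zs.
have law_eta' B : measurable B -> Q (eta' @^-1` B) = Q (eta @^-1` B).
  move=> mB; have := law_n setT setT B measurableT measurableT mB.
  by rewrite !preimage_setT !setTI QT PT !mul1e.
split => //.
move=> B M mB mM; rewrite setIC muleC.
have mB' : measurable (eta' @^-1` B) by exact: (measurable_preimage meta').
apply: (joint_law_rectangles mzs mxis mzs mxis mB') => //.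
  by rewrite fin_num_measure.
move=> C D mC mD; rewrite law_zs_xis// law_zs// law_eta'//.
exact: law_n.
Qed.
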